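(* Let $d\geq 2$ be an integer. There exist a constant $C_d>0$ and a function $\beta_d\colon[0,\infty)\to[0,\infty)$ such that both of the following hold. (i) For every $\begin{bmatrix}a&\overline b\\ b&\overline a\end{bmatrix}\in\mathrm{SU}(1,1)$, $$C_d^{-1}(\ln|a|)^{1/2}\leq\beta_d(|b|)\leq C_d(\ln|a|)^{1/2}.$$ (ii) Whenever matrices $\begin{bmatrix}a_j&\overline{b_j}\\ b_j&\overline{a_j}\end{bmatrix},\ \begin{bmatrix}A_k&\overline{B_k}\\ B_k&\overline{A_k}\end{bmatrix}\in\mathrm{SU}(1,1)$, $j,k=0,1,\ldots,d-1$, satisfy $$\begin{bmatrix}A_k&\overline{B_k}\\ B_k&\overline{A_k}\end{bmatrix}=\prod_{j=0}^{d-1}\begin{bmatrix}a_j&\overline{b_j}\,e^{-2\pi ijk/d}\\ b_j\,e^{2\pi ijk/d}&\overline{a_j}\end{bmatrix}\qquad\text{for } k=0,1,\ldots,d-1,$$ then for any pair of conjugated exponents $1<p\leq2$ and $2\leq q<\infty$ (that is, $\frac1p+\frac1q=1$) one has $$\Big(\frac1d\sum_{k=0}^{d-1}\beta_d(|B_k|)^q\Big)^{1/q}\leq\Big(\sum_{j=0}^{d-1}\beta_d(|b_j|)^p\Big)^{1/p}.$$ (The constant $C_d$ and the function $\beta_d$ depend only on $d$, not on $p,q$ or the matrices.)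
   Context: $\mathrm{SU}(1,1)=\left\{\begin{bmatrix}a&\overline b\\ b&\overline a\end{bmatrix}: a,b\in\mathbb{C},\ |a|^2-|b|^2=1\right\}$. Matrix products $\prod_{j=0}^{d-1}M_j$ are taken in ascending order, i.e. $M_0M_1\cdots M_{d-1}$. *)

(* Defs.v *)
From mathcomp Require Export all_boot all_order all_algebra.
From mathcomp Require Export all_classical all_reals all_analysis.
From mathcomp Require Export complex.

Set Implicit Arguments.
Unset Strict Implicit.
Unset Printing Implicit Defensive.

Import Order.TTheory GRing.Theory Num.Theory.
Import numFieldNormedType.Exports.

Local Open Scope classical_set_scope.
Local Open Scope ring_scope.
Local Open Scope complex_scope.

(* The modulus as an element of R: for z : R[i], `|z| has type R[i]. *)
Definition cabs (R : realType) (z : R[i]) : R := complex.Re `|z|.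

Definition expi (R : realType) (t : R) : R[i] := cos t +i* sin t.

Definition mx2 (T : Type) (x y z w : T) : 'M[T]_2 :=
  \matrix_(i < 2, j < 2)
    if i == ord0 then (if j == ord0 then x else y)
    else (if j == ord0 then z else w).

Definition su_mx (R : realType) (a b : R[i]) : 'M[R[i]]_2 :=
  mx2 a (conjc b) b (conjc a).

Definition SU11 (R : realType) : set 'M[R[i]]_2 :=
  [set M | exists a b : R[i],
     cabs a ^+ 2 - cabs b ^+ 2 = 1 /\ M = su_mx a b].
Arguments SU11 : clear implicits.

Lemma cabsE (R : realType) (z : R[i]) :
  cabs z = Num.sqrt (complex.Re z ^+ 2 + complex.Im z ^+ 2).
Proof. by rewrite /cabs normc_def. Qed.

Lemma SU11_su_mx (R : realType) (a b : R[i]) :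
  SU11 R (su_mx a b) <-> cabs a ^+ 2 - cabs b ^+ 2 = 1.
Proof.
split=> [[a' [b' [H /matrixP E]]]|H]; last by exists a, b.
by move: (E ord0 ord0) (E ord_max ord0); rewrite !mxE /= => -> ->.
Qed.

(* Main.v *)
Require Import Defs.
From mathcomp Require Import ring lra.

(** The function is beta(t) = sqrt (ln (1 + K t^2)) with a large K depending only
on d.  Since ln |a| = (1/2) ln (1 + |b|^2) on SU(1,1), and ln (1 + K u) lies
between ln (1 + u) and K ln (1 + u), part (i) holds for every K >= 1.

For part (ii), expand B_k = sum_j c_j e^{2 pi i j k / d}; the coefficients c_j
do not depend on k ([prod_coef], [prod_su_mxE]).  Three steps lead from the
left-hand side to the right-hand side.

- Jensen ([jensen_ln1D]): the L^q mean of beta(|B_k|) is at most beta of the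
  L^q mean of |B_k|, because ln (1 + u) lies below its tangents and the
  power q/2 >= 1 is convex.

- The sharp linear Hausdorff-Young inequality ([hausdorff_young]): the L^q mean
  of |B_k| is at most the l^p norm of c.  The proof is in the spirit of F. Riesz.
  A maximizer f of |Tf|_q on the unit
  sphere of l^p is, up to a scalar, the dual power of T^*(|Tf|^{q-2} Tf), by
  the equality case of Young's inequality.  Parseval's identity then reads as
  an inequality at the exponent 2q-2, and the optimal constants W(q) (for q-th
  powers) satisfy W(q)^2 <= W(2q-2) ([HY_bound_step]).  As W <= d for every
  exponent, iteration gives W(q) <= d^(1/2^n) for all n, hence W(q) <= 1.

- A nonlinear inequality for the coefficients ([prod_coef_ln_bound]):
  beta(|c|_p)^p <= sum_j beta(|b_j|)^p.  Here the strict concavity of beta pays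
  for the nonlinear terms.  Let x be the largest |b_j|, attained at m, and rho
  the second largest.  Every monomial of c_j other than b_j prod_{l<>j} a_l contains
  at least three off-diagonal entries with distinct indices, so at least two
  factors bounded by rho; hence, if rho <= 1, |c_m| <= x + C x rho^2, and
  |c_j| <= |b_j| |a_m| + C x rho^2 for j <> m ([prod_coef_dominant]).  With
  u = K x^2, the map w^P |-> ln(1 + w)^P has at u the slope
  th (ln(1+u)/u)^P, where th = u / ((1+u) ln(1+u)) and P = p/2, and stays below
  its tangent for w >= u ([ln1D_powR_slope]).  The factor th < 1 is the gain.  If x <= 1 it
  absorbs the relative error O(x^2) ([ln_bound_max_le1]); if rho <= 1 <= x the
  small entries are measured by the much larger slope of ln near 0
  ([ln_bound_max_ge1]); if rho >= 1 two factors 1 + K |b_j|^2 are large, and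
  their product exceeds the crude bound for 1 + K |c|_p^2
  ([ln_bound_two_ge1]). *)

Set Implicit Arguments.
Unset Strict Implicit.
Unset Printing Implicit Defensive.

Import Order.TTheory GRing.Theory Num.Theory.
Import numFieldNormedType.Exports.

Local Open Scope ring_scope.
Local Open Scope complex_scope.

(** * Moduli and conjugates *)

Lemma cabsC (R : realType) (z : R[i]) : (cabs z)%:C = `|z|.
Proof. by []. Qed.

Lemma cabs_ge0 (R : realType) (z : R[i]) : 0 <= cabs z.
Proof. by rewrite cabsE sqrtr_ge0. Qed.

Lemma cabsM (R : realType) (y z : R[i]) : cabs (y * z) = cabs y * cabs z.
Proof. exact: Normc.normcM. Qed.

Lemma cabs0 (R : realType) : cabs (0 : R[i]) = 0.
Proof. exact: Normc.normc0. Qed.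

Lemma cabs_eq0 (R : realType) (z : R[i]) : cabs z = 0 -> z = 0.
Proof. exact: Normc.eq0_normc. Qed.

Lemma cabsJ (R : realType) (z : R[i]) : cabs (conjc z) = cabs z.
Proof. by rewrite !cabsE; case: z => x y /=; rewrite sqrrN. Qed.

Lemma cabs_real (R : realType) (x : R) : cabs x%:C = `|x|.
Proof. by rewrite cabsE /= expr0n /= addr0 sqrtr_sqr. Qed.

Lemma ler_cabsD (R : realType) (y z : R[i]) : cabs (y + z) <= cabs y + cabs z.
Proof. exact: le_normcD. Qed.

Lemma ler_cabs_sum (R : realType) (I : finType) (f : I -> R[i]) :
  cabs (\sum_i f i) <= \sum_i cabs (f i).
Proof.
apply: (big_ind2 (fun (z : R[i]) r => cabs z <= r)) => [|z r z' r' zr zr'|//].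
  by rewrite cabs0.
exact: le_trans (ler_cabsD z z') (lerD zr zr').
Qed.

Lemma sqr_cabs (R : realType) (z : R[i]) : (cabs z ^+ 2)%:C = z * conjc z.
Proof. by rewrite rmorphXn /= cabsC sqr_normc. Qed.

Lemma cabs_sqr (R : realType) (z : R[i]) :
  cabs z ^+ 2 = complex.Re z ^+ 2 + complex.Im z ^+ 2.
Proof. by rewrite cabsE sqr_sqrtr // addr_ge0 ?sqr_ge0. Qed.

Lemma conjcM (R : realType) (y z : R[i]) : conjc (y * z) = conjc y * conjc z.
Proof. exact: rmorphM. Qed.

Lemma conjcD (R : realType) (y z : R[i]) : conjc (y + z) = conjc y + conjc z.
Proof. exact: rmorphD. Qed.

Lemma conjc_sum (R : realType) (I : finType) (f : I -> R[i]) :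
  conjc (\sum_i f i) = \sum_i conjc (f i).
Proof. exact: rmorph_sum. Qed.

(** * Weighted means *)

(** With m the weighted mean of the logarithms, both numbers lie above the
    tangent of exp at m, and these tangents average to exp m. *)
Lemma weighted_amgm (R : realType) (l x y : R) : 0 <= l <= 1 -> 0 <= x -> 0 <= y ->
  x `^ l * y `^ (1 - l) <= l * x + (1 - l) * y.
Proof.
move=> /andP[l0 l1] x0 y0.
have [->|x1] := eqVneq x 0.
  have [->|ln0] := eqVneq l 0.
    by rewrite powRr0 subr0 powRr1 // !mul1r mul0r add0r.
  by rewrite powR0 // mul0r mulr0 add0r mulr_ge0 // subr_ge0.
have [->|y1] := eqVneq y 0.
  have [->|ln0] := eqVneq l 1.
    by rewrite subrr powRr0 powRr1 // mul1r mulr1 mul0r addr0.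
  by rewrite (powR0 (x := 1 - l)) ?subr_eq0 1?eq_sym // !mulr0 addr0 mulr_ge0.
have xp : 0 < x by rewrite lt_def x1.
have yp : 0 < y by rewrite lt_def y1.
rewrite /powR (negbTE x1) (negbTE y1) -expRD.
set m := _ + _.
have hx : expR m * (1 + (ln x - m)) <= x.
  rewrite -[leRHS](@lnK _ x) ?posrE // -[X in _ <= expR X](subrKC m) (expRD m).
  by rewrite ler_wpM2l ?expR_ge0 // expR_ge1Dx.
have hy : expR m * (1 + (ln y - m)) <= y.
  rewrite -[leRHS](@lnK _ y) ?posrE // -[X in _ <= expR X](subrKC m) (expRD m).
  by rewrite ler_wpM2l ?expR_ge0 // expR_ge1Dx.
have -> : expR m = l * (expR m * (1 + (ln x - m)))
    + (1 - l) * (expR m * (1 + (ln y - m))) by rewrite /m; ring.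
by apply: lerD; apply: ler_wpM2l; rewrite ?subr_ge0.
Qed.

(** Equality forces both logarithms to touch the tangent of exp at their
    mean.  This replaces the Lagrange multiplier equation for extremizers. *)
Lemma weighted_amgm_eq (R : realType) (l s t : R) : 0 < l < 1 -> 0 <= s -> 0 <= t ->
  l * s + (1 - l) * t <= s `^ l * t `^ (1 - l) -> s = t.
Proof.
move=> /andP[l0 l1] s0 t0.
have l1' : 0 < 1 - l by rewrite subr_gt0.
have [->|s1] := eqVneq s 0.
  rewrite powR0 ?gt_eqF // mul0r mulr0 add0r pmulr_rle0 // => t0'.
  by apply/eqP; rewrite eq_le t0 t0'.
have [->|t1] := eqVneq t 0.
  rewrite (powR0 (x := 1 - l)) ?gt_eqF // !mulr0 addr0 pmulr_rle0 // => s0'.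
  by apply/eqP; rewrite eq_le s0 s0'.
have sp : 0 < s by rewrite lt_def s1.
have tp : 0 < t by rewrite lt_def t1.
rewrite /powR (negbTE s1) (negbTE t1) -expRD.
set m := l * ln s + _ => H.
have hs : expR m * (1 + (ln s - m)) <= s.
  rewrite -[leRHS](@lnK _ s) ?posrE // -[X in _ <= expR X](subrKC m) (expRD m).
  by rewrite ler_wpM2l ?expR_ge0 // expR_ge1Dx.
have ht : expR m * (1 + (ln t - m)) <= t.
  rewrite -[leRHS](@lnK _ t) ?posrE // -[X in _ <= expR X](subrKC m) (expRD m).
  by rewrite ler_wpM2l ?expR_ge0 // expR_ge1Dx.
have E : expR m = l * (expR m * (1 + (ln s - m)))
    + (1 - l) * (expR m * (1 + (ln t - m))) by rewrite /m; ring.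
have [es|ns] := eqVneq (ln s) m.
  apply: ln_inj; rewrite ?posrE // es.
  have : (1 - l) * ln s = (1 - l) * ln t.
    by rewrite es; move: (es); rewrite {1}/m; nra.
  by move=> /(mulfI (lt0r_neq0 l1')) <-.
have hs' : expR m * (1 + (ln s - m)) < s.
  rewrite -[ltRHS](@lnK _ s) ?posrE // -[X in _ < expR X](subrKC m) (expRD m).
  by rewrite ltr_pM2l ?expR_gt0 // expR_gt1Dx // subr_eq0.
exfalso; move: H; apply/negP; rewrite -ltNge {1}E.
by apply: ltr_leD; [rewrite ltr_pM2l|rewrite ler_pM2l].
Qed.

Lemma powRV (R : realType) (x r : R) : 0 <= x -> (x^-1) `^ r = (x `^ r)^-1.
Proof. by move=> x0; rewrite -(powR_inv1 x0) -powRrM mulN1r powRN. Qed.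

Lemma hoelder_sum (R : realType) (I : finType) (w p q : R) (u v : I -> R) :
  0 < w -> 1 < p -> 1 < q -> p^-1 + q^-1 = 1 ->
  (forall i, 0 <= u i) -> (forall i, 0 <= v i) ->
  w * \sum_i u i * v i
  <= (w * \sum_i u i `^ p) `^ p^-1 * (w * \sum_i v i `^ q) `^ q^-1.
Proof.
move=> w0 p1 q1 pq u0 v0.
have p0 : 0 < p by lra.
have q0 : 0 < q by lra.
have normalise (A B s t : R) : 0 < A -> 0 < B -> 0 <= s -> 0 <= t ->
    (A `^ p^-1 * B `^ q^-1)^-1 * (s * t) = (s `^ p / A) `^ p^-1 * (t `^ q / B) `^ q^-1.
  move=> /ltW A0 /ltW B0 s0 t0.
  rewrite !powRM ?powR_ge0 ?invr_ge0 // -!powRrM !divff ?gt_eqF // !powRr1 // !powRV //.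
  by rewrite invfM mulrC mulrACA.
set A := w * \sum_i _ `^ p; set B := w * \sum_i _ `^ q.
have zero (f : I -> R) (r : R) : 0 < r -> (forall i, 0 <= f i) -> w * \sum_i f i `^ r = 0 ->
    forall i, f i = 0.
  move=> r0 f0 /eqP; rewrite mulf_eq0 gt_eqF //= psumr_eq0 => [/allP H i|i _].
    have /H : i \in index_enum I by rewrite mem_index_enum.
    by rewrite powR_eq0 (gt_eqF r0) andbT => /eqP.
  exact: powR_ge0.
have [A0|A0] := eqVneq A 0.
  rewrite big1 ?mulr0 ?mulr_ge0 ?powR_ge0 // => i _.
  by rewrite (zero u p p0 u0 A0 i) mul0r.
have [B0|B0] := eqVneq B 0.
  rewrite big1 ?mulr0 ?mulr_ge0 ?powR_ge0 // => i _.
  by rewrite (zero v q q0 v0 B0 i) mulr0.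
have Age : 0 <= A by rewrite mulr_ge0 ?(ltW w0) // sumr_ge0 // => i _; exact: powR_ge0.
have Bge : 0 <= B by rewrite mulr_ge0 ?(ltW w0) // sumr_ge0 // => i _; exact: powR_ge0.
have Ap : 0 < A by rewrite lt_def A0.
have Bp : 0 < B by rewrite lt_def B0.
set D := A `^ _ * _.
have Dp : 0 < D by rewrite mulr_gt0 ?powR_gt0.
rewrite -[leRHS]mulr1 -ler_pdivrMl //.
have -> : 1 = w * \sum_i (p^-1 * (u i `^ p / A) + q^-1 * (v i `^ q / B)).
  rewrite big_split /= -!mulr_sumr -!mulr_suml mulrDr mulrCA (mulrCA w q^-1).
  by rewrite !(mulrA w) -/A -/B !divff // !mulr1.
rewrite mulrCA ler_pM2l // mulr_sumr; apply: ler_sum => i _.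
rewrite normalise //.
have -> : q^-1 = 1 - p^-1 by lra.
apply: weighted_amgm; rewrite ?divr_ge0 ?powR_ge0 //.
by rewrite invr_ge0 ltW //= invf_le1 // ltW.
Qed.

(** * Extremizers of a finite transform *)

(** Away from 0 this is differentiability of the power; at 0 the exponent
    is positive, so the neighbourhood of radius e^(1/r) works. *)
Lemma continuous_normr_powR (R : realType) (r : R) : 0 < r ->
  continuous (fun t : R => `|t| `^ r).
Proof.
move=> r0 t; have [->|t0] := eqVneq t 0.
  rewrite /continuous_at normr0 powR0 ?gt_eqF //.
  apply/cvgrPdist_lt => /= e e0.
  exists (e `^ r^-1) => /=; first exact: powR_gt0.
  move=> s /=; rewrite sub0r normrN => se.
  rewrite sub0r normrN ger0_norm ?powR_ge0 //.
  have -> : e = (e `^ r^-1) `^ r by rewrite -powRrM mulVf ?gt_eqF // powRr1 // ltW.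
  by rewrite gt0_ltr_powR // nnegrE ?powR_ge0.
have nt : 0 < `|t| by rewrite normr_gt0.
apply: (@continuous_comp _ _ _ (fun t : R => `|t|) (fun s => s `^ r)).
  exact: norm_continuous.
apply: differentiable_continuous; apply/derivable1_diffP.
by apply: derivable_powR; rewrite in_itv /= andbT.
Qed.

Lemma continuous_sumr (R : realType) (T : topologicalType) (I : finType)
    (F : I -> T -> R) :
  (forall i, continuous (F i)) -> continuous (fun x => \sum_i F i x).
Proof.
by move=> cF; apply: continuous_big => [|i _]; [exact: add_continuous|exact: cF].
Qed.

Lemma Re_sum (R : realType) (I : finType) (f : I -> R[i]) :
  complex.Re (\sum_i f i) = \sum_i complex.Re (f i).
Proof. by apply: (big_morph _ (id1 := 0) (op1 := +%R)) => // -[a b] [c e]. Qed.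

Lemma Im_sum (R : realType) (I : finType) (f : I -> R[i]) :
  complex.Im (\sum_i f i) = \sum_i complex.Im (f i).
Proof. by apply: (big_morph _ (id1 := 0) (op1 := +%R)) => // -[a b] [c e]. Qed.

Lemma continuous_cabs_powR (R : realType) (T : topologicalType) (f : T -> R[i])
    (r : R) : 0 < r ->
  continuous (fun x => complex.Re (f x)) -> continuous (fun x => complex.Im (f x)) ->
  continuous (fun x => cabs (f x) `^ r).
Proof.
move=> r0 cR cI.
have -> : (fun x => cabs (f x) `^ r) =
    (fun t : R => `|t| `^ (r / 2)) \o
    (fun x => complex.Re (f x) * complex.Re (f x) + complex.Im (f x) * complex.Im (f x)).
  apply/funext => x /=; rewrite -!expr2 -cabs_sqr ger0_norm ?sqr_ge0 //.
  rewrite -powR_mulrn ?cabs_ge0 // -powRrM; congr (_ `^ _).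
  by rewrite mulrC divfK // pnatr_eq0.
move=> x; apply: continuous_comp; last by apply: continuous_normr_powR; rewrite divr_gt0.
by apply: continuousD; apply: continuousM; (exact: cR || exact: cI).
Qed.

Definition transform (R : realType) (d : nat) (e : 'I_d -> 'I_d -> R[i])
    (f : 'I_d -> R[i]) (k : 'I_d) : R[i] := \sum_j f j * e k j.

(** Vectors of C^d are coded by their real and imaginary parts, so that
    compactness can be read off in a real vector space. *)
Definition complex_vec (R : realType) (d : nat) (v : 'rV[R]_(d + d)) (j : 'I_d) : R[i] :=
  v ord0 (lshift d j) +i* v ord0 (rshift d j).

Lemma transform_maximizer (R : realType) (d : nat) (e : 'I_d -> 'I_d -> R[i]) (p q : R) :
  (0 < d)%N -> 0 < p -> 0 < q ->
  exists2 f : 'I_d -> R[i], \sum_j cabs (f j) `^ p = 1 &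
    forall g : 'I_d -> R[i], \sum_j cabs (g j) `^ p = 1 ->
      \sum_k cabs (transform e g k) `^ q <= \sum_k cabs (transform e f k) `^ q.
Proof.
move=> d0 p0 q0.
pose N (v : 'rV[R]_(d + d)) := \sum_j cabs (complex_vec v j) `^ p.
pose F (v : 'rV[R]_(d + d)) := \sum_k cabs (transform e (complex_vec v) k) `^ q.
have cco i : continuous (fun v : 'rV[R]_(d + d) => v ord0 i).
  exact: coord_continuous.
have cmul i x : continuous (fun v : 'rV[R]_(d + d) => v ord0 i * x).
  by move=> v; apply: continuousM; [exact: cco|exact: cst_continuous].
have cN : continuous N.
  apply: continuous_sumr => j; apply: continuous_cabs_powR => //.
    exact: (cco (lshift d j)).
  exact: (cco (rshift d j)).
have cF : continuous F.
  apply: continuous_sumr => k; apply: continuous_cabs_powR => //.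
    rewrite /transform; under eq_fun do rewrite Re_sum.
    apply: continuous_sumr => j v; rewrite /complex_vec; case: (e k j) => x y /=.
    exact: (continuousB (cmul _ x v) (cmul _ y v)).
  rewrite /transform; under eq_fun do rewrite Im_sum.
  apply: continuous_sumr => j v; rewrite /complex_vec; case: (e k j) => x y /=.
  exact: (continuousD (cmul _ y v) (cmul _ x v)).
pose toV (f : 'I_d -> R[i]) : 'rV[R]_(d + d) :=
  row_mx (\row_j complex.Re (f j)) (\row_j complex.Im (f j)).
have toVK f : complex_vec (toV f) = f.
  by apply/funext => j; rewrite /complex_vec row_mxEl row_mxEr !mxE; case: (f j).
pose A := [set v | N v = 1]%classic.
have Acl : closed A.
  apply: (@preimage_closed _ _ N [set x | x = 1]%classic) => [v _|].
    exact: cN.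
  exact: closed_eq.
have cube := @rV_compact R (d + d) (fun=> `[-1, 1]%classic) (fun=> @segment_compact R (-1) 1).
have Acpt : compact A.
  apply: subclosed_compact Acl cube _ => v Nv i /=; rewrite in_itv /= -ler_norml.
  have le1 j : cabs (complex_vec v j) <= 1.
    rewrite leNgt; apply/negP => lt1.
    have : 1 < cabs (complex_vec v j) `^ p.
      by have := gt0_ltr_powR p0 _ _ lt1; rewrite powR1 !nnegrE ?cabs_ge0; apply.
    rewrite ltNge -Nv /N (bigD1 j) //= lerDl sumr_ge0 // => ? _.
    exact: powR_ge0.
  case: (split_ordP i) => j ->; apply: le_trans (le1 j);
    rewrite -ler_sqr ?nnegrE ?normr_ge0 ?cabs_ge0 // real_normK ?num_real //
      cabs_sqr /= ?lerDl ?lerDr sqr_ge0 //.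
have A0 : (A !=set0)%classic.
  pose j0 : 'I_d := Ordinal d0.
  exists (toV (fun j => if j == j0 then 1 else 0)).
  rewrite /A /= /N toVK (bigD1 j0) //= big1 => [|j /negbTE ->].
    by rewrite -[1]/(1%:C) cabs_real normr1 powR1 addr0.
  by rewrite cabs0 powR0 // gt_eqF.
have [v /set_mem Av vmax] :=
  EVT_max_rV A0 Acpt (continuous_subspaceT cF).
exists (complex_vec v) => // g Ng.
by have := vmax (toV g); rewrite /F toVK; apply; apply/mem_set; rewrite /A /= /N toVK.
Qed.

(** * The Hausdorff-Young inequality *)

(** W bounds the q-th power of the norm of T from l^p (counting measure) to
    L^q (normalised counting measure), p = q/(q-1) being the conjugate exponent.
    Working with q-th powers makes the recursion between exponents multiplicative. *)
Definition HY_bound (R : realType) (d : nat) (e : 'I_d -> 'I_d -> R[i]) (q W : R) :=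
  forall f : 'I_d -> R[i],
    d%:R^-1 * \sum_k cabs (transform e f k) `^ q
    <= W * (\sum_j cabs (f j) `^ (q / (q - 1))) `^ (q - 1).

Section HausdorffYoung.
Variables (R : realType) (d : nat) (e : 'I_d -> 'I_d -> R[i]).
Hypothesis d_gt0 : (0 < d)%N.
Hypothesis e_le1 : forall k j, cabs (e k j) <= 1.
Hypothesis e_orth : forall k l, \sum_j e k j * conjc (e l j) = (d * (k == l))%:R.

Let dR : 0 < d%:R :> R. Proof. by rewrite ltr0n. Qed.

(** From |Tf| <= |f|_1 and Hoelder's inequality against the constant 1. *)
Lemma HY_bound_trivial (q : R) : 2 <= q -> HY_bound e q d%:R.
Proof.
move=> q2 f; set p := q / (q - 1).
have q1 : q - 1 != 0 by rewrite gt_eqF //; lra.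
have q0 : q != 0 by rewrite gt_eqF //; lra.
have qgt1 : 1 < q by lra.
have q_ge0 : 0 <= q by lra.
have p1 : 1 < p by rewrite /p ltr_pdivlMr; lra.
have pV : p^-1 = (q - 1) / q by rewrite /p invf_div.
have pq : p^-1 + q^-1 = 1 by rewrite pV; field.
set S := \sum_j cabs (f j).
have S0 : 0 <= S by apply: sumr_ge0 => j _; exact: cabs_ge0.
have TS k : cabs (transform e f k) <= S.
  apply: le_trans (ler_cabs_sum _) _; apply: ler_sum => j _.
  by rewrite cabsM ler_piMr ?cabs_ge0.
have SN : S `^ q <= d%:R * (\sum_j cabs (f j) `^ p) `^ (q - 1).
  have := @hoelder_sum R 'I_d 1 p q (fun j => cabs (f j)) (fun=> 1).
  move=> /(_ ltr01 p1 _ pq (fun j => cabs_ge0 _) (fun=> ler01)).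
  rewrite !mul1r => H.
  have {H} : S <= (\sum_j cabs (f j) `^ p) `^ p^-1 * (d%:R) `^ q^-1.
    rewrite /S; under [leLHS]eq_bigr do rewrite -[cabs _]mulr1.
    apply: le_trans (H qgt1) _.
    under [X in _ * X `^ _]eq_bigr do rewrite powR1.
    by rewrite sumr_const card_ord.
  move=> /(ge0_ler_powR _ _ _) -/(_ q).
  rewrite !nnegrE mulr_ge0 ?powR_ge0 // => /(_ _ S0 isT) H.
  apply: le_trans (H q_ge0) _.
  rewrite powRM ?powR_ge0 // -!powRrM mulVf // powRr1 ?ler0n // mulrC.
  by rewrite pV divfK.
apply: le_trans SN; rewrite mulrC ler_pdivrMr //.
apply: (@le_trans _ _ (\sum_(k < d) S `^ q)); last first.
  by rewrite sumr_const card_ord mulr_natr.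
apply: ler_sum => k _; apply: ge0_ler_powR; by rewrite ?nnegrE ?cabs_ge0.
Qed.

(** The adjoint for counting measure on the source and normalised counting
    measure on the target. *)
Definition adj_transform (G : 'I_d -> R[i]) (j : 'I_d) : R[i] :=
  (d%:R^-1)%:C * \sum_k conjc (e k j) * G k.

Lemma transform_adjE (f G : 'I_d -> R[i]) :
  \sum_j f j * conjc (adj_transform G j) = (d%:R^-1)%:C * \sum_k transform e f k * conjc (G k).
Proof.
transitivity ((d%:R^-1)%:C * \sum_j \sum_k f j * e k j * conjc (G k)).
  rewrite mulr_sumr; apply: eq_bigr => j _.
  rewrite /adj_transform conjcM conjc_real conjc_sum mulrCA; congr (_ * _).
  rewrite mulr_sumr; apply: eq_bigr => k _.
  by rewrite conjcM conjcK mulrA.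
rewrite exchange_big /=; congr (_ * _); apply: eq_bigr => k _.
by rewrite /transform mulr_suml.
Qed.

(** Orthogonality of the rows of a square matrix makes the adjoint a right
    inverse, which is what turns the adjoint into an isometry of L^2. *)
Lemma transform_adjK (G : 'I_d -> R[i]) (k : 'I_d) : transform e (adj_transform G) k = G k.
Proof.
have dC : (d%:R : R[i]) != 0 by rewrite pnatr_eq0 -lt0n.
transitivity ((d%:R^-1)%:C * \sum_l (\sum_j e k j * conjc (e l j)) * G l).
  rewrite /transform /adj_transform mulr_sumr.
  under [RHS]eq_bigr do rewrite mulr_suml mulr_sumr.
  rewrite exchange_big /=; apply: eq_bigr => j _.
  rewrite -mulrA mulr_suml mulr_sumr; apply: eq_bigr => l _.
  by ring.
under eq_bigr do rewrite e_orth.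
rewrite (bigD1 k) //= eqxx muln1 big1 ?addr0 => [|l /negbTE lk]; last first.
  by rewrite eq_sym lk muln0 mul0r.
by rewrite fmorphV /= rmorph_nat mulKf.
Qed.

Lemma adj_parseval (G : 'I_d -> R[i]) :
  \sum_j cabs (adj_transform G j) ^+ 2 = d%:R^-1 * \sum_k cabs (G k) ^+ 2.
Proof.
apply: complexI.
rewrite rmorph_sum rmorphM rmorph_sum /=.
under eq_bigr do rewrite sqr_cabs.
under [in RHS]eq_bigr do rewrite sqr_cabs.
rewrite transform_adjE; congr (_ * _); apply: eq_bigr => k _.
by rewrite transform_adjK.
Qed.

Lemma transformZ (c : R[i]) (f : 'I_d -> R[i]) (k : 'I_d) :
  transform e (fun j => c * f j) k = c * transform e f k.
Proof. by rewrite /transform mulr_sumr; apply: eq_bigr => j _; rewrite mulrA. Qed.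

(** The element |z|^(r-2) z, dual to z for the exponent r. *)
Definition dual_power (r : R) (z : R[i]) : R[i] := (cabs z `^ (r - 2))%:C * z.

Lemma cabs_dual_power (r : R) (z : R[i]) : 1 < r -> cabs (dual_power r z) = cabs z `^ (r - 1).
Proof.
move=> r1; rewrite cabsM cabs_real ger0_norm ?powR_ge0 //.
have [->|z0] := eqVneq (cabs z) 0; first by rewrite mulr0 powR0 // gt_eqF // subr_gt0.
rewrite -[X in _ * X]powRr1 ?cabs_ge0 // -powRD; last by rewrite z0 implybT.
by congr (_ `^ _); ring.
Qed.

Lemma mul_dual_power (r : R) (z : R[i]) : 0 < r ->
  z * conjc (dual_power r z) = (cabs z `^ r)%:C.
Proof.
move=> r0; rewrite /dual_power conjcM conjc_real mulrCA -sqr_cabs -rmorphM /=.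
have [->|z0] := eqVneq (cabs z) 0; first by rewrite expr0n mulr0 powR0 // gt_eqF.
rewrite -powR_mulrn ?cabs_ge0 // -powRD ?z0 ?implybT //.
by congr (_ `^ _)%:C; ring.
Qed.

(** Homogeneity extends the bound from the unit sphere of l^p to all vectors. *)
Lemma HY_bound_of_maximizer (q W : R) (f0 : 'I_d -> R[i]) : 2 <= q ->
  \sum_j cabs (f0 j) `^ (q / (q - 1)) = 1 ->
  W = d%:R^-1 * \sum_k cabs (transform e f0 k) `^ q ->
  (forall g : 'I_d -> R[i], \sum_j cabs (g j) `^ (q / (q - 1)) = 1 ->
      \sum_k cabs (transform e g k) `^ q <= \sum_k cabs (transform e f0 k) `^ q) ->
  HY_bound e q W.
Proof.
move=> q2; set p := q / (q - 1) => Nf0 WE maxf0 f.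
have q1 : q - 1 != 0 by rewrite gt_eqF //; lra.
have q0 : 0 < q by lra.
have p0 : 0 < p by rewrite divr_gt0 //; lra.
set N := \sum_j _ `^ p.
have Nge : 0 <= N by apply: sumr_ge0 => j _; exact: powR_ge0.
have [N0|N0] := eqVneq N 0.
  have f_0 j : f j = 0.
    apply: cabs_eq0; move/eqP: N0; rewrite psumr_eq0 => [/allP H|i _].
      have /H : j \in index_enum 'I_d by rewrite mem_index_enum.
      by rewrite powR_eq0 (gt_eqF p0) andbT => /eqP.
    exact: powR_ge0.
  rewrite N0 powR0 // mulr0 big1 ?mulr0 // => k _.
  by rewrite /transform big1 => [|j _]; rewrite ?f_0 ?mul0r // cabs0 powR0 // gt_eqF.
have Np : 0 < N by rewrite lt_def N0.
set t := N `^ (- p^-1).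
have t0 : 0 < t by exact: powR_gt0.
have tp : t `^ p * N = 1.
  by rewrite /t -powRrM mulNr mulVf ?gt_eqF // powR_inv1 // mulVf.
have cabst (z : R[i]) r : cabs (t%:C * z) `^ r = t `^ r * cabs z `^ r.
  by rewrite cabsM cabs_real gtr0_norm // powRM ?cabs_ge0 // ltW.
have := maxf0 (fun j => t%:C * f j).
under eq_bigr do rewrite cabst.
rewrite -mulr_sumr -/N tp => /(_ erefl).
under eq_bigr do rewrite transformZ cabst.
rewrite -mulr_sumr => H.
rewrite WE -mulrA ler_pM2l ?invr_gt0 //.
have tq : t `^ q * N `^ (q - 1) = 1.
  rewrite /t -powRrM -powRD ?N0 ?implybT //.
  have -> : - p^-1 * q + (q - 1) = 0 by rewrite /p; field; rewrite q1 gt_eqF.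
  by rewrite powRr0.
set S := \sum_k cabs (transform e f k) `^ q in H *.
have -> : S = t `^ q * S * N `^ (q - 1) by rewrite mulrAC tq mul1r.
by apply: ler_wpM2r => //; exact: powR_ge0.
Qed.

(** Hoelder's inequality for the moments of u, normalised at the exponent b,
    in a form that still makes sense for l = 1. *)
Lemma sum_powR_logconvex (p1 a b l : R) (I : finType) (u : I -> R) :
  0 < l <= 1 -> 0 < a -> 0 < b -> p1 = l * a + (1 - l) * b ->
  (forall i, 0 <= u i) -> \sum_i u i `^ b = 1 -> 0 < \sum_i u i `^ a ->
  \sum_i u i `^ p1 <= (\sum_i u i `^ a) `^ l.
Proof.
move=> /andP[l0 l1] a0 b0 pE u0 sb; set A := \sum_i _ `^ a => A0.
rewrite -[leRHS]mulr1 -ler_pdivrMl ?powR_gt0 //.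
have -> : 1 = \sum_i (l * (u i `^ a / A) + (1 - l) * u i `^ b).
  rewrite big_split /= -!mulr_sumr -mulr_suml sb divff ?gt_eqF //.
  by ring.
rewrite mulr_sumr; apply: ler_sum => i _.
have p10 : 0 < p1 by rewrite pE ltr_wpDr ?mulr_gt0 // mulr_ge0 ?subr_ge0 // ltW.
have -> : (A `^ l)^-1 * u i `^ p1 = (u i `^ a / A) `^ l * (u i `^ b) `^ (1 - l).
  rewrite powRM ?powR_ge0 ?invr_ge0 ?(ltW A0) // -!powRrM powRV ?(ltW A0) //.
  rewrite mulrAC mulrC; congr (_ * _).
  have [->|ui] := eqVneq (u i) 0.
    by rewrite (powR0 (x := p1)) ?gt_eqF // (powR0 (x := a * l)) ?mul0r // mulf_neq0 ?gt_eqF.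
  rewrite -powRD ?ui ?implybT //; congr (_ `^ _).
  by rewrite pE mulrC (mulrC b).
by apply: weighted_amgm; rewrite ?divr_ge0 ?powR_ge0 ?(ltW A0) ?(ltW l0).
Qed.

(** The heart of the Hausdorff-Young inequality.  Let f be a maximizer,
    g = Tf, G = |g|^(q-2) g, h = T^*G.  Duality bounds |h|_q by W, while
    |f|_p = 1 and <f,h> = |g|_q^q = W; so Hoelder's inequality for <f,h> is an equality and
    |h| = W |f|^(p-1).  Parseval turns this into
    W^2 sum |f|^(2p-2) = mean |g|^(2q-2), and the right-hand side is controlled
    by the bound at the exponent 2q-2 together with log-convexity of moments,
    whose exponents match exactly. *)
Lemma HY_bound_step (q W1 : R) : 2 <= q -> 0 <= W1 ->
  HY_bound e (2 * q - 2) W1 -> HY_bound e q (Num.sqrt W1).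
Proof.
move=> q2 W10 HW1; set p := q / (q - 1).
have q1 : q - 1 != 0 by rewrite gt_eqF //; lra.
have q1p : 0 < q - 1 by lra.
have q0 : 0 < q by lra.
have qn0 : q != 0 by rewrite gt_eqF.
have qgt1 : 1 < q by lra.
have p0 : 0 < p by rewrite divr_gt0 //; lra.
have p1 : 1 < p by rewrite /p ltr_pdivlMr; lra.
have pV : p^-1 = (q - 1) / q by rewrite /p invf_div.
have pq : p^-1 + q^-1 = 1 by rewrite pV; field.
have dV : 0 < d%:R^-1 :> R by rewrite invr_gt0.
have [f Nf maxf] := transform_maximizer e d_gt0 p0 q0.
pose W := d%:R^-1 * \sum_k cabs (transform e f k) `^ q.
have W0 : 0 <= W by rewrite mulr_ge0 ?(ltW dV) // sumr_ge0 // => k _; exact: powR_ge0.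
have HW : HY_bound e q W by exact: HY_bound_of_maximizer Nf erefl maxf.
suff WW1 : W <= Num.sqrt W1.
  move=> u; apply: le_trans (HW u) _; apply: ler_wpM2r => //; exact: powR_ge0.
have [W00|Wn0] := eqVneq W 0; first by rewrite W00 sqrtr_ge0.
have Wp : 0 < W by rewrite lt_def Wn0.
pose g := transform e f.
pose G k := dual_power q (g k).
pose h := adj_transform G.
have cG k : cabs (G k) = cabs (g k) `^ (q - 1) by exact: cabs_dual_power.
have fh : \sum_j f j * conjc (h j) = W%:C.
  rewrite transform_adjE /W rmorphM rmorph_sum; congr (_ * _); apply: eq_bigr => k _.
  by rewrite mul_dual_power.
have W_le : W <= \sum_j cabs (f j) * cabs (h j).
  have := ler_cabs_sum (fun j => f j * conjc (h j)).
  rewrite fh cabs_real gtr0_norm //.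
  by under eq_bigr do rewrite cabsM cabsJ.
pose H j := dual_power q (h j).
have cH j : cabs (H j) = cabs (h j) `^ (q - 1) by exact: cabs_dual_power.
pose Y := \sum_j cabs (h j) `^ q.
have Y0 : 0 <= Y by apply: sumr_ge0 => j _; exact: powR_ge0.
have Hh : \sum_j H j * conjc (h j) = Y%:C.
  rewrite /Y rmorph_sum; apply: eq_bigr => j _.
  by rewrite -[LHS]conjcK conjcM conjcK mulrC mul_dual_power // conjc_real.
have qp : (q - 1) * p = q by rewrite /p mulrC divfK.
have Y_le : Y <= W * Y `^ p^-1.
  apply: (@le_trans _ _ (d%:R^-1 * \sum_k cabs (G k) * cabs (transform e H k))).
    have : cabs (\sum_j H j * conjc (h j)) <= d%:R^-1 * \sum_k cabs (G k) * cabs (transform e H k).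
      rewrite transform_adjE cabsM cabs_real gtr0_norm // ler_wpM2l ?(ltW dV) //.
      apply: le_trans (ler_cabs_sum _) _; apply: ler_sum => k _.
      by rewrite cabsM cabsJ mulrC.
    by rewrite Hh cabs_real ger0_norm.
  apply: le_trans (hoelder_sum dV p1 qgt1 pq _ _) _; try by move=> k; exact: cabs_ge0.
  under eq_bigr do rewrite cG -powRrM qp.
  rewrite -/g -/W.
  apply: (@le_trans _ _ (W `^ p^-1 * (W * Y `^ (q - 1)) `^ q^-1)).
    apply: ler_wpM2l; first exact: powR_ge0.
    apply: ge0_ler_powR; rewrite ?nnegrE.
    - by rewrite invr_ge0 (ltW q0).
    - by rewrite mulr_ge0 ?(ltW dV) // sumr_ge0 // => k _; exact: powR_ge0.
    - by rewrite mulr_ge0 // powR_ge0.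
    have -> : Y = \sum_j cabs (H j) `^ p by apply: eq_bigr => j _; rewrite cH -powRrM qp.
    exact: HW.
  rewrite (@powRM _ W) ?powR_ge0 // mulrA -powRD ?pq ?oner_eq0 // powRr1 //.
  by rewrite -powRrM -pV.
have Y_leW : Y <= W `^ q.
  have [->|Yn0] := eqVneq Y 0; first exact: powR_ge0.
  have Yp : 0 < Y by rewrite lt_def Yn0.
  have : Y `^ q^-1 <= W.
    rewrite -(ler_pM2r (powR_gt0 p^-1 Yp)); apply: le_trans Y_le.
    by rewrite -powRD ?Yn0 ?implybT // addrC pq powRr1.
  move=> /(ge0_ler_powR (ltW q0)); rewrite !nnegrE powR_ge0 => /(_ isT W0).
  by rewrite -powRrM mulVf // powRr1.
(* Equality in Young's inequality, term by term: both families have sum at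
   most 1, and their weighted geometric means sum to at least 1. *)
pose x j := cabs (f j) `^ p.
pose y j := (cabs (h j) / W) `^ q.
have xy j : cabs (f j) * (cabs (h j) / W) = x j `^ p^-1 * y j `^ (1 - p^-1).
  have -> : 1 - p^-1 = q^-1 by lra.
  rewrite /x /y -!powRrM !divff ?gt_eqF // !powRr1 ?cabs_ge0 //.
  by rewrite divr_ge0 ?cabs_ge0.
have pVb : 0 < p^-1 < 1 by rewrite invr_gt0 p0 invf_lt1.
have x0 j : 0 <= x j by exact: powR_ge0.
have y0 j : 0 <= y j by exact: powR_ge0.
have termle j : x j `^ p^-1 * y j `^ (1 - p^-1) <= p^-1 * x j + (1 - p^-1) * y j.
  by apply: weighted_amgm => //; case/andP: pVb => /ltW -> /ltW ->.
have sumx : \sum_j x j = 1 by [].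
have sumy : \sum_j y j <= 1.
  have -> : \sum_j y j = Y / W `^ q.
    rewrite /Y mulr_suml; apply: eq_bigr => j _.
    by rewrite /y powRM ?cabs_ge0 ?invr_ge0 // (powRV _ W0).
  by rewrite ler_pdivrMr ?powR_gt0 // mul1r.
have sumxy : 1 <= \sum_j x j `^ p^-1 * y j `^ (1 - p^-1).
  under eq_bigr do rewrite -xy mulrA.
  by rewrite -mulr_suml ler_pdivlMr // mul1r.
have eqxy j : x j = y j.
  apply: (weighted_amgm_eq pVb (x0 j) (y0 j)).
  rewrite leNgt; apply/negP => lt_j.
  have : \sum_j x j `^ p^-1 * y j `^ (1 - p^-1)
       < \sum_j (p^-1 * x j + (1 - p^-1) * y j).
    rewrite (bigD1 j) //= [ltRHS](bigD1 j) //=.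
    by apply: ltr_leD => //; apply: ler_sum => i _; exact: termle.
  rewrite big_split /= -!mulr_sumr sumx => /(le_lt_trans sumxy).
  apply/negP; rewrite -leNgt mulr1 -lerBrDl -[leRHS]mulr1 ler_wpM2l //.
  by case/andP: pVb => _ /ltW; rewrite subr_ge0.
have ch j : cabs (h j) = W * cabs (f j) `^ (p - 1).
  have /(congr1 (fun z => z `^ q^-1)) := eqxy j.
  rewrite /x /y -!powRrM divff // powRr1 ?divr_ge0 ?cabs_ge0 // => E.
  rewrite -[LHS](divfK Wn0) -E mulrC; congr (_ * _ `^ _).
  have -> : q^-1 = 1 - p^-1 by lra.
  by rewrite mulrBr mulr1 divff ?gt_eqF.
pose A := \sum_j cabs (f j) `^ (2 * p - 2).
have p22 : 0 < 2 * p - 2 by lra.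
have A0 : 0 < A.
  have A_ge : 0 <= A by apply: sumr_ge0 => j _; exact: powR_ge0.
  rewrite lt_def A_ge andbT; apply/eqP => Az.
  move: Nf; rewrite big1 => [/eqP|j _]; first by rewrite eq_sym oner_eq0.
  have -> : cabs (f j) = 0.
    move/eqP: Az; rewrite psumr_eq0 => [/allP Hj|i _]; last exact: powR_ge0.
    have /Hj : j \in index_enum 'I_d by rewrite mem_index_enum.
    by rewrite powR_eq0 (gt_eqF p22) andbT => /eqP.
  by rewrite powR0 // gt_eqF.
(* Parseval for G, read through |h| = W |f|^(p-1). *)
have WA : W ^+ 2 * A = d%:R^-1 * \sum_k cabs (g k) `^ (2 * q - 2).
  transitivity (\sum_j cabs (h j) ^+ 2).
    rewrite mulr_sumr; apply: eq_bigr => j _.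
    rewrite ch (exprMn _ W (_ `^ _)) -(powR_mulrn _ (powR_ge0 _ _)) -powRrM; congr (_ * _ `^ _).
    by ring.
  rewrite adj_parseval; congr (_ * _); apply: eq_bigr => k _.
  by rewrite cG -powR_mulrn ?powR_ge0 // -powRrM; congr (_ `^ _); ring.
have q23 : 0 < 2 * q - 3 by lra.
have := HW1 f; rewrite -/g -WA.
have -> : 2 * q - 2 - 1 = 2 * q - 3 by ring.
have logc : \sum_j cabs (f j) `^ ((2 * q - 2) / (2 * q - 3)) <= A `^ (2 * q - 3)^-1.
  apply: (@sum_powR_logconvex _ (2 * p - 2) p) => //.
  - by rewrite invr_gt0 q23 invf_le1 //=; lra.
  - by rewrite /p; field; rewrite q1 gt_eqF.
  - by move=> j; exact: cabs_ge0.
move=> HWA; have {HWA} : W ^+ 2 * A <= W1 * A.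
  apply: le_trans HWA _; apply: ler_wpM2l => //.
  have -> : A = (A `^ (2 * q - 3)^-1) `^ (2 * q - 3).
    by rewrite -powRrM mulVf ?gt_eqF // powRr1 // ltW.
  apply: ge0_ler_powR => //; rewrite ?nnegrE ?powR_ge0 ?(ltW q23) //.
  by apply: sumr_ge0 => j _; exact: powR_ge0.
rewrite ler_pM2r // => HW2.
by rewrite -(ler_sqr W0 (sqrtr_ge0 _)) sqr_sqrtr.
Qed.

Lemma HY_bound_iter (n : nat) (q : R) : 2 <= q ->
  HY_bound e q (iter n (@Num.sqrt R) d%:R).
Proof.
elim: n q => [|n IH] q q2; first exact: HY_bound_trivial.
rewrite iterS; apply: HY_bound_step => //; last by apply: IH; lra.
by case: n {IH} => [|n] /=; rewrite ?ler0n ?sqrtr_ge0.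
Qed.

(** If the n-th iterated root exceeds 1 + eps, then c > (1 + eps)^(2^n), and
    Bernoulli's inequality bounds n. *)
Lemma iter_sqrt_near1 (c eps : R) : 0 <= c -> 0 < eps ->
  exists n, iter n (@Num.sqrt R) c <= 1 + eps.
Proof.
move=> c0 eps0.
pose N := (Num.truncn (c / eps)).+1.
have cN : c < N%:R * eps by rewrite -ltr_pdivrMr // truncnS_gt.
exists N; rewrite leNgt; apply/negP => big.
have pow (n : nat) (x : R) : 0 <= x -> 1 + eps < iter n (@Num.sqrt R) x ->
    (1 + eps) ^+ (2 ^ n) < x.
  elim: n x => [|n IH] x x0; first by rewrite expn0 expr1.
  rewrite iterSr => /(IH _ (sqrtr_ge0 x)) lt.
  rewrite -(sqr_sqrtr x0) expnS mulnC exprM ltr_sqr ?nnegrE ?sqrtr_ge0 //.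
  by rewrite exprn_ge0 //; lra.
have bern (m : nat) : 1 + m%:R * eps <= (1 + eps) ^+ m.
  elim: m => [|m IH]; first by rewrite mul0r addr0 expr0.
  rewrite exprS -[m.+1]addn1 natrD.
  have m0 : 0 <= m%:R :> R by [].
  by nra.
have := bern (2 ^ N)%N; have := pow N c c0 big.
have : N%:R <= (2 ^ N)%:R :> R by rewrite ler_nat ltnW // ltn_expl.
by nra.
Qed.

Lemma HY_bound_1 (q : R) : 2 <= q -> HY_bound e q 1.
Proof.
move=> q2 f; rewrite mul1r; set X := _ * _; set Z := _ `^ (q - 1).
have Z0 : 0 <= Z by exact: powR_ge0.
apply/ler_addgt0Pr => eps eps0.
have Z1 : 0 < Z + 1 by lra.
have [n nP] := @iter_sqrt_near1 d%:R (eps / (Z + 1)) (ltW dR) (divr_gt0 eps0 Z1).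
apply: le_trans (HY_bound_iter n q2 f) _; rewrite -/Z.
apply: le_trans (ler_wpM2r Z0 nP) _.
rewrite mulrDl mul1r lerD2l mulrAC ler_pdivrMr //.
by nra.
Qed.

Lemma hausdorff_young (p q : R) (f : 'I_d -> R[i]) :
  1 < p -> 2 <= q -> p^-1 + q^-1 = 1 ->
  (d%:R^-1 * \sum_k cabs (transform e f k) `^ q) `^ q^-1
  <= (\sum_j cabs (f j) `^ p) `^ p^-1.
Proof.
move=> p1 q2 pq.
have q1 : q - 1 != 0 by rewrite gt_eqF //; lra.
have q0 : q != 0 by rewrite gt_eqF //; lra.
have p0 : p != 0 by rewrite gt_eqF //; lra.
have pV : p^-1 = (q - 1) / q.
  by rewrite mulrBl divff // mul1r; lra.
have pE : p = q / (q - 1) by rewrite -[p]invrK pV invf_div.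
have := HY_bound_1 q2 f; rewrite mul1r -pE.
move=> /(ge0_ler_powR _ _ _) -/(_ q^-1).
rewrite !nnegrE powR_ge0 invr_ge0 => H.
apply: le_trans (H _ _ isT) _; first by lra.
  by rewrite mulr_ge0 ?invr_ge0 ?ler0n // sumr_ge0 // => k _; exact: powR_ge0.
by rewrite -powRrM -pV.
Qed.
End HausdorffYoung.

(** * The discrete Fourier matrix *)

Lemma expiD (R : realType) (s t : R) : expi (s + t) = expi s * expi t.
Proof.
rewrite /expi cosD sinD; apply/eqP; rewrite eq_complex /=.
by apply/andP; split; apply/eqP; ring.
Qed.

Lemma expi0 (R : realType) : expi (0 : R) = 1.
Proof. by rewrite /expi cos0 sin0. Qed.

Lemma expiN (R : realType) (t : R) : expi (- t) = conjc (expi t).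
Proof. by rewrite /expi cosN sinN. Qed.

Lemma cabs_expi (R : realType) (t : R) : cabs (expi t) = 1.
Proof. by rewrite cabsE /= cos2Dsin2 sqrtr1. Qed.

Lemma expi_2pi (R : realType) (n : nat) : expi (2 * pi * n%:R : R) = 1.
Proof.
elim: n => [|n IH]; first by rewrite mulr0 expi0.
rewrite -[n.+1]addn1 natrD mulrDr mulr1 expiD IH mul1r /expi mulr_natl.
by rewrite cos2pi sin2pi.
Qed.

(** By cos t = 1 - 2 sin(t/2)^2 and positivity of sin on the open interval
    from 0 to pi. *)
Lemma expi_eq1 (R : realType) (t : R) : 0 < t < 2 * pi -> expi t != 1.
Proof.
move=> /andP[t0 t1]; rewrite eq_complex negb_and; apply/orP; left => /=.
have -> : t = t / 2 + t / 2 by lra.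
rewrite cosD -!expr2.
have : 0 < sin (t / 2) by apply: sin_gt0_pi; lra.
have := cos2Dsin2 (t / 2) => H s0; apply/eqP => H'.
have : 0 < sin (t / 2) ^+ 2 by rewrite exprn_gt0.
by lra.
Qed.

Section DFT.
Variables (R : realType) (d : nat).
Local Notation N := d.+1.

Definition dft (k j : 'I_N) : R[i] := expi (2 * pi * j%:R * k%:R / N%:R).

Lemma cabs_dft k j : cabs (dft k j) = 1. Proof. exact: cabs_expi. Qed.

Lemma expi_mod (m : nat) (k : 'I_N) :
  expi (2 * pi * (m %% N)%:R * k%:R / N%:R : R) = expi (2 * pi * m%:R * k%:R / N%:R).
Proof.
have N0 : N%:R != 0 :> R by rewrite pnatr_eq0.
rewrite [in RHS](divn_eq m N) natrD natrM.
have -> : 2 * pi * ((m %/ N)%:R * N%:R + (m %% N)%:R) * k%:R / N%:R =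
  2 * pi * ((m %/ N) * k)%:R + 2 * pi * (m %% N)%:R * k%:R / N%:R :> R.
  by rewrite natrM; field; rewrite addrC natr1.
by rewrite expiD expi_2pi mul1r.
Qed.

Lemma dftD (k i j : 'I_N) : dft k (i + j) = dft k i * dft k j.
Proof.
rewrite /dft /= expi_mod natrD -expiD; congr expi.
by rewrite mulrDr !mulrDl.
Qed.

Lemma dft0 k : dft k 0 = 1.
Proof. by rewrite /dft /= mulr0 !mul0r expi0. Qed.

Lemma dftN (k j : 'I_N) : dft k (- j) = conjc (dft k j).
Proof.
have := cabs_dft k j => c1.
have E : dft k (- j) * dft k j = 1 by rewrite -dftD addNr dft0.
have F : dft k j * conjc (dft k j) = 1 by rewrite -sqr_cabs c1 expr1n.
by rewrite -[LHS]mulr1 -F mulrA E mul1r.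
Qed.

Lemma dft_sym (k j : 'I_N) : dft k j = dft j k.
Proof. by rewrite /dft -!mulrA (mulrCA j%:R). Qed.

(** The sum S of a nontrivial character is invariant under a shift of the
    index, hence S = S z with z <> 1. *)
Lemma dft_orth (k l : 'I_N) :
  \sum_j dft k j * conjc (dft l j) = (N * (k == l))%:R.
Proof.
have -> : \sum_j dft k j * conjc (dft l j) = \sum_j dft j (k - l).
  by apply: eq_bigr => j _; rewrite dftD dftN !(dft_sym j).
have [->|kl] := eqVneq k l.
  under eq_bigr do rewrite subrr dft0.
  by rewrite sumr_const card_ord muln1.
rewrite muln0; set m := k - l.
have m0 : m != 0 by rewrite subr_eq0.
have m_gt0 : (0 < m)%N by rewrite lt0n; apply: contra m0 => /eqP m0; apply/eqP/val_inj.
have N_gt1 : (1 < N)%N by apply: leq_ltn_trans (ltn_ord m).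
pose o : 'I_N := inord 1.
have o1 : dft m o != 1.
  rewrite /dft /o inordK // mulr1; apply: expi_eq1.
  have N0 : 0 < N%:R :> R by rewrite ltr0n.
  have mR : 0 < m%:R :> R by rewrite ltr0n.
  have mN : m%:R < N%:R :> R by rewrite ltr_nat.
  have pi0 : 0 < 2 * pi :> R by rewrite mulr_gt0 // pi_gt0.
  rewrite !divr_gt0 ?mulr_gt0 ?pi_gt0 //= ltr_pdivrMr //.
  by rewrite ltr_pM2l.
under eq_bigr do rewrite dft_sym.
set S := \sum_j _.
have : S * dft m o = S.
  rewrite /S mulr_suml [RHS](reindex_inj (addIr o)) /=.
  by apply: eq_bigr => j _; rewrite dftD.
move/eqP; rewrite -subr_eq0 -{2}[S]mulr1 -mulrBr mulf_eq0 subr_eq0 (negbTE o1) orbF.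
by move/eqP.
Qed.

Lemma transform_shift (f : 'I_N -> R[i]) (n k : 'I_N) :
  transform dft (fun j => f (j - n)) k = transform dft f k * dft k n.
Proof.
rewrite /transform (reindex_inj (addIr n)) mulr_suml /=.
by apply: eq_bigr => j _; rewrite addrK dftD mulrA.
Qed.
End DFT.

Lemma mx2_mul (T : comNzRingType) (x y z w x' y' z' w' : T) :
  mx2 x y z w * mx2 x' y' z' w' =
  mx2 (x * x' + y * z') (x * y' + y * w') (z * x' + w * z') (z * y' + w * w').
Proof.
apply/matrixP => i j; rewrite !mxE !big_ord_recl big_ord0 addr0 !mxE /=.
by case: ifP; case: ifP.
Qed.

Lemma su_mx_mul (R : realType) (a b a' b' : R[i]) :
  su_mx a b * su_mx a' b' = su_mx (a * a' + conjc b * b') (b * a' + conjc a * b').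
Proof.
rewrite /su_mx mx2_mul; congr mx2; last by rewrite conjcD !conjcM conjcK addrC.
by rewrite conjcD !conjcM conjcK addrC.
Qed.

Lemma su_mx_inj (R : realType) (a b a' b' : R[i]) :
  su_mx a b = su_mx a' b' -> a = a' /\ b = b'.
Proof.
by move=> /matrixP E; move: (E ord0 ord0) (E ord_max ord0); rewrite !mxE /=.
Qed.

Section Coefficients.
Variables (R : realType) (d : nat) (a b : 'I_d.+1 -> R[i]).
Local Notation N := d.+1.

(** The Fourier coefficients, indexed by Z/d, of the lower left entry B and of
    the conjugate E of the upper left entry of a partial product; B and E obey
    a linear recursion in which a frequency shift replaces the character. *)
Fixpoint prod_coef (n : nat) : ('I_N -> R[i]) * ('I_N -> R[i]) :=
  if n is n'.+1 then
    let m : 'I_N := inord n' in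
    let: (c, e) := prod_coef n' in
    (fun j => a m * c j + b m * e (j - m),
     fun j => conjc (a m) * e j + conjc (b m) * c (j + m))
  else (fun=> 0, fun j => (j == 0)%:R).

Lemma prod_su_mxE (n : nat) (k : 'I_N) : (n <= N)%N ->
  \prod_(j < n) su_mx (a (inord j)) (b (inord j) * dft R k (inord j)) =
  su_mx (conjc (transform (@dft R d) (prod_coef n).2 k)) (transform (@dft R d) (prod_coef n).1 k).
Proof.
elim: n => [|n IH] nN.
  rewrite big_ord0 /transform /=.
  rewrite (bigD1 0) //= mul1r dft0 big1 => [|j /negbTE ->]; last by rewrite mul0r.
  rewrite big1 => [|j _]; last by rewrite mul0r.
  rewrite addr0 conjc1 /su_mx conjc1 conjc0; apply/matrixP => i j; rewrite !mxE.
  by case: i j => [[|[|i]] ?] // [[|[|j]] ?].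
rewrite big_ord_recr /= IH ?(ltnW nN) // su_mx_mul conjcK.
case: (prod_coef n) => c e /=; set m : 'I_N := inord n.
have E1 : transform (@dft R d) (fun j => a m * c j + b m * e (j - m)) k =
    transform (@dft R d) c k * a m + transform (@dft R d) e k * (b m * dft R k m).
  rewrite mulrCA -transform_shift mulrC -!transformZ /transform -big_split /=.
  by apply: eq_bigr => j _; rewrite mulrDl.
have E2 : transform (@dft R d) (fun j => conjc (a m) * e j + conjc (b m) * c (j + m)) k =
    transform (@dft R d) e k * conjc (a m) + transform (@dft R d) c k * conjc (b m * dft R k m).
  have -> : transform (@dft R d) c k * conjc (b m * dft R k m) =
      conjc (b m) * transform (@dft R d) (fun j => c (j + m)) k.
    have := transform_shift c (- m) k; under eq_fun do rewrite opprK.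
    by move=> ->; rewrite dftN conjcM mulrCA.
  rewrite mulrC -!transformZ /transform -big_split /=.
  by apply: eq_bigr => j _; rewrite mulrDl.
by rewrite E1 E2 conjcD !conjcM !conjcK.
Qed.
End Coefficients.

(** * Size of the Fourier coefficients of a product *)

Section CoefficientBounds.
Variables (R : realType) (d : nat) (a b : 'I_d.+1 -> R[i]).
Local Notation N := d.+1.
Hypothesis ab : forall j, cabs (a j) ^+ 2 - cabs (b j) ^+ 2 = 1.
Local Notation x j := (cabs (b j)).
Local Notation al j := (cabs (a j)).

Lemma SU11_diag_ge1 j : 1 <= al j.
Proof.
rewrite -(ler_sqr (x := 1)) ?nnegrE ?cabs_ge0 // expr1n.
by have := ab j; have := sqr_ge0 (cabs (b j)); lra.
Qed.

Lemma SU11_diag_leD j : al j <= 1 + x j.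
Proof.
have x0 := cabs_ge0 (b j).
rewrite -ler_sqr ?nnegrE ?cabs_ge0 ?addr_ge0 //.
by have := ab j; nra.
Qed.

Lemma SU11_diag_leD2 j : al j <= 1 + x j ^+ 2.
Proof.
have x0 := sqr_ge0 (cabs (b j)).
rewrite -ler_sqr ?nnegrE ?cabs_ge0 ?addr_ge0 //.
by have := ab j; nra.
Qed.

Lemma prod_coefS1 n j : cabs ((prod_coef a b n.+1).1 j)
  <= al (inord n) * cabs ((prod_coef a b n).1 j) +
     x (inord n) * cabs ((prod_coef a b n).2 (j - inord n)).
Proof. by rewrite /=; case: (prod_coef a b n) => c e /=; rewrite -!cabsM; exact: ler_cabsD. Qed.

Lemma prod_coefS2 n j : cabs ((prod_coef a b n.+1).2 j)
  <= al (inord n) * cabs ((prod_coef a b n).2 j) +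
     x (inord n) * cabs ((prod_coef a b n).1 (j + inord n)).
Proof.
rewrite /=; case: (prod_coef a b n) => c e /=; rewrite -(cabsJ (a _)) -(cabsJ (b _)) -!cabsM.
exact: ler_cabsD.
Qed.

(** Each of the two coefficients is a sum of monomials whose moduli are
    distinct terms of the expanded product of the |a_l| + |b_l|. *)
Lemma prod_coef_le_prod n j :
  cabs ((prod_coef a b n).1 j) <= \prod_(l < n) (al (inord l) + x (inord l)) /\
  cabs ((prod_coef a b n).2 j) <= \prod_(l < n) (al (inord l) + x (inord l)).
Proof.
elim: n j => [|n IH] j.
  rewrite big_ord0 /= cabs0 ler01; split => //.
  rewrite -[_%:R](rmorph_nat (real_complex R)) cabs_real normr_nat.
  by case: (j == 0); rewrite ?ler01.
rewrite big_ord_recr /=; set P := \prod_(_ < _) _.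
have al0 := cabs_ge0 (a (inord n)); have x0 := cabs_ge0 (b (inord n)).
split; [apply: le_trans (prod_coefS1 n j) _|apply: le_trans (prod_coefS2 n j) _];
  rewrite mulrDr (mulrC P) (mulrC P); apply: lerD; apply: ler_wpM2l => //;
  exact: (IH _).1 || exact: (IH _).2.
Qed.

Section Dominant.
Variables (m : 'I_N) (rho : R).
Hypothesis rho0 : 0 <= rho.
Hypothesis rho1 : rho <= 1.
Hypothesis rhox : rho <= x m.
Hypothesis x_rho : forall j : 'I_N, j != m -> x j <= rho.

(** X and A bound the off-diagonal and the diagonal part of the factors
   processed so far: the dominant factor enters once n > m. *)
Let X (n : nat) : R := if (m < n)%N then x m else rho.
Let A (n : nat) : R := if (m < n)%N then al m else 1.
(** State after n factors, the errors being measured by K.  The lower left entry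
   consists of its linear terms and a cubic error X rho^2, the upper left one of
   the diagonal product and a quadratic error.  The constant K grows by a factor
   8 per step, a round bound for the number of error terms created. *)
Let coef_inv n (K : R) := forall j : 'I_N,
  [/\ j != m -> cabs ((prod_coef a b n).1 j)
        <= (if (j < n)%N then x j * A n else 0) + K * (X n * rho ^+ 2),
      cabs ((prod_coef a b n).1 m) <= (if (m < n)%N then x m else 0) + K * (X n * rho ^+ 2),
      cabs ((prod_coef a b n).2 0) <= A n + K * (A n * rho ^+ 2) &
      j != 0 -> cabs ((prod_coef a b n).2 j) <= K * (X n * rho)].

(** A factor with |b_i| <= rho and |a_i| <= 1 + rho^2 multiplies the bounds by
    1 + O(rho^2) and transfers mass between B and E with a factor rho; each
    error term then carries the powers of rho required by the invariant. *)
Lemma coef_inv_step_other n K (nN : (n < N)%N) : 1 <= K -> n != m :> nat ->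
  coef_inv n K -> coef_inv n.+1 (8 * K).
Proof.
move=> K1 nm H.
pose i : 'I_N := inord n.
have iE : i = n :> nat by rewrite inordK.
have im : i != m by rewrite -val_eqE /= iE.
have xi := x_rho im; have xi0 := cabs_ge0 (b i).
have ai1 := SU11_diag_ge1 i; have ai : al i <= 1 + rho ^+ 2.
  apply: le_trans (SU11_diag_leD2 i) _; rewrite lerD2l ler_sqr ?nnegrE ?cabs_ge0 //.
have XS : X n.+1 = X n by rewrite /X ltnS leq_eqVlt eq_sym (negbTE nm).
have AS : A n.+1 = A n by rewrite /A ltnS leq_eqVlt eq_sym (negbTE nm).
have mS : (m < n.+1)%N = (m < n)%N by rewrite ltnS leq_eqVlt eq_sym (negbTE nm).
have rX : rho <= X n by rewrite /X; case: ifP.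
have XA : X n <= A n.
  rewrite /X /A; case: ifP => _ //.
  by rewrite -ler_sqr ?nnegrE ?cabs_ge0 //; have := ab m; lra.
have A1 : 1 <= A n by rewrite /A; case: ifP => _ //; exact: SU11_diag_ge1.
have AX : A n <= 1 + X n.
  by rewrite /A /X; case: ifP => _; [exact: SU11_diag_leD|lra].
have X0 : 0 <= X n by exact: le_trans rX.
have xA (j : 'I_N) : j != m -> 0 <= x j * A n <= 2 * X n.
  move=> jm; have := x_rho jm; have := cabs_ge0 (b j) => ? ?.
  apply/andP; split; first by rewrite mulr_ge0 //; lra.
  have : x j * A n <= x j * (1 + X n) by rewrite ler_wpM2l.
  have : x j * X n <= X n by rewrite ler_piMl //; exact: le_trans (x_rho jm) rho1.
  by lra.
have rr : rho ^+ 2 <= 1 by rewrite expr_le1.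
have r20 := sqr_ge0 rho.
have K0 : 0 <= K by lra.
have Kr : 0 <= K * (X n * rho ^+ 2) by rewrite !mulr_ge0.
have Xr : 0 <= X n * rho ^+ 2 by rewrite mulr_ge0.
set Q := X n * rho ^+ 2 in Kr Xr *.
(* Multiplying s by |a_i| <= 1 + rho^2 costs rho^2 times any bound for s. *)
have absorb s t : 0 <= s -> s <= t -> al i * s <= s + rho ^+ 2 * t.
  move=> s0 st; have : (al i - 1) * s <= rho ^+ 2 * t by apply: ler_pM => //; lra.
  by lra.
have KQ : rho ^+ 2 * (K * Q) <= K * Q by rewrite ler_piMl.
have cu j : cabs ((prod_coef a b n).1 j) <= 2 * X n + K * X n.
  have [cj cm _ _] := H j.
  have KQX : K * Q <= K * X n by rewrite ler_wpM2l // /Q ler_piMr.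
  have [->|jm] := eqVneq j m.
    apply: le_trans cm _; rewrite -/Q.
    have : (if (m < n)%N then x m else 0) <= X n by rewrite /X; case: ifP.
    by lra.
  apply: le_trans (cj jm) _; have /andP[_ ?] := xA j jm.
  by case: ifP => _; rewrite -/Q; lra.
move=> j; have [cj cm e0 ej] := H j; rewrite mS XS AS -/Q; split.
- move=> jm; apply: le_trans (prod_coefS1 n j) _; rewrite -/i.
  have {cj} := cj jm; rewrite -/Q; have /andP[xA0 xA2] := xA j jm.
  have [ji|ji] := eqVneq j i.
    rewrite ji iE ltnn ltnS leqnn subrr add0r => cj.
    have := absorb _ _ (cabs_ge0 _) cj => h1.
    have : x i * cabs ((prod_coef a b n).2 0) <= x i * (A n + K * (A n * rho ^+ 2)).
      by apply: ler_wpM2l.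
    have : x i * A n * (K * rho ^+ 2) <= 2 * X n * (K * rho ^+ 2).
      by apply: ler_wpM2r; [rewrite mulr_ge0|rewrite -ji].
    have -> : x i * (A n + K * (A n * rho ^+ 2)) = x i * A n + x i * A n * (K * rho ^+ 2).
      by ring.
    have -> : 2 * X n * (K * rho ^+ 2) = 2 * (K * Q) by rewrite /Q; ring.
    by lra.
  have -> : (j < n.+1)%N = (j < n)%N.
    by rewrite ltnS leq_eqVlt -iE val_eqE (negbTE ji).
  move=> cj.
  have h2 : x i * cabs ((prod_coef a b n).2 (j - i)) <= rho * (K * (X n * rho)).
    apply: ler_pM => //; first exact: cabs_ge0.
    by have [_ _ _] := H (j - i); apply; rewrite subr_eq0.
  have h3 : rho * (K * (X n * rho)) = K * Q by rewrite /Q; ring.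
  have K8 : Q <= K * Q by rewrite ler_peMl.
  have := absorb _ _ (cabs_ge0 _) cj; case: ifP cj => _ cj h1.
    have : rho ^+ 2 * (x j * A n) <= 2 * Q by rewrite /Q; nra.
    by lra.
  by lra.
- apply: le_trans (prod_coefS1 n m) _; rewrite -/i.
  have h2 : x i * cabs ((prod_coef a b n).2 (m - i)) <= rho * (K * (X n * rho)).
    apply: ler_pM => //; first exact: cabs_ge0.
    by have [_ _ _] := H (m - i); apply; rewrite subr_eq0 eq_sym.
  have h3 : rho * (K * (X n * rho)) = K * Q by rewrite /Q; ring.
  have K8 : Q <= K * Q by rewrite ler_peMl.
  rewrite -/Q in cm.
  have := absorb _ _ (cabs_ge0 _) cm; case: ifP cm => mn cm h1.
    have : rho ^+ 2 * x m <= Q by rewrite /Q /X mn mulrC.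
    by lra.
  by lra.
- apply: le_trans (prod_coefS2 n 0) _; rewrite -/i add0r.
  have := absorb _ _ (cabs_ge0 _) e0.
  have [ci _ _ _] := H i; have {ci} := ci im; rewrite iE ltnn add0r -/Q => ci.
  have QA : rho * Q <= A n * rho ^+ 2.
    rewrite /Q mulrA; apply: ler_wpM2r => //.
    by apply: le_trans XA; rewrite ler_piMl.
  have : x i * cabs ((prod_coef a b n).1 i) <= rho * (K * Q).
    by apply: ler_pM => //; exact: cabs_ge0.
  set V := A n * rho ^+ 2 in e0 QA *.
  have V0 : 0 <= V by rewrite mulr_ge0 //; lra.
  have : rho ^+ 2 * (K * V) <= K * V by rewrite ler_piMl // mulr_ge0.
  have : V <= K * V by rewrite ler_peMl.
  have : rho * (K * Q) <= K * V by rewrite mulrCA ler_wpM2l.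
  have : rho ^+ 2 * A n = V by rewrite /V mulrC.
  by lra.
- move=> j0; apply: le_trans (prod_coefS2 n j) _; rewrite -/i.
  have {ej} := ej j0; set Z := X n * rho => ej.
  have Z0 : 0 <= Z by rewrite mulr_ge0.
  have := absorb _ _ (cabs_ge0 _) ej.
  have : rho ^+ 2 * (K * Z) <= K * Z by rewrite ler_piMl // mulr_ge0.
  have : x i * cabs ((prod_coef a b n).1 (j + i)) <= rho * (2 * X n + K * X n).
    by apply: ler_pM => //; exact: cabs_ge0.
  have : Z <= K * Z by rewrite ler_peMl.
  have : rho * (2 * X n + K * X n) = 2 * Z + K * Z by rewrite /Z; ring.
  by lra.
Qed.

(** At the dominant factor, everything accumulated so far has size given by
    rho alone.  A loss of |a_m| <= 1 + x is harmless because rho <= x: it turns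
    rho^3 into at most 2 x rho^2. *)
Lemma coef_inv_step_dominant n K : 1 <= K -> n = m :> nat ->
  coef_inv n K -> coef_inv n.+1 (8 * K).
Proof.
move=> K1 nm H.
have iE : inord n = m :> 'I_N by rewrite nm inord_val.
have [XS AS mS mn] : [/\ X n.+1 = x m, A n.+1 = al m, (m < n.+1)%N & (m < n)%N = false].
  by rewrite /X /A -nm ltnS leqnn ltnn.
have [Xn An] : X n = rho /\ A n = 1 by rewrite /X /A mn.
have x0 := cabs_ge0 (b m); have a1 := SU11_diag_ge1 m; have ax := SU11_diag_leD m.
have a0 : 0 <= al m by lra.
have rr : rho ^+ 2 <= 1 by rewrite expr_le1.
have r20 := sqr_ge0 rho.
have K0 : 0 <= K by lra.
set Q := x m * rho ^+ 2.
have Q0 : 0 <= Q by rewrite mulr_ge0.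
have K8 : Q <= K * Q by rewrite ler_peMl.
have KQ0 : 0 <= K * Q by rewrite mulr_ge0.
have r3 : rho * rho ^+ 2 <= Q by rewrite ler_wpM2r.
have ar3 : al m * (K * (rho * rho ^+ 2)) <= 2 * (K * Q).
  have : al m * (rho * rho ^+ 2) <= 2 * Q.
    have : x m * (rho * rho ^+ 2) <= Q by rewrite /Q mulrCA ler_piMl.
    have r30 : 0 <= rho * rho ^+ 2 by rewrite mulr_ge0.
    have : al m * (rho * rho ^+ 2) <= (1 + x m) * (rho * rho ^+ 2) by rewrite ler_wpM2r.
    by lra.
  by move=> /(ler_wpM2l K0); rewrite mulrCA; lra.
rewrite /coef_inv Xn An mn in H.
move=> j; have [cj cm e0 ej] := H j; rewrite mS XS AS -/Q; split.
- move=> jm; apply: le_trans (prod_coefS1 n j) _; rewrite iE.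
  have {cj} := cj jm; rewrite mulr1 => cj.
  have -> : (j < n.+1)%N = (j < n)%N.
    by rewrite ltnS leq_eqVlt nm val_eqE (negbTE jm).
  have h2 : x m * cabs ((prod_coef a b n).2 (j - m)) <= x m * (K * (rho * rho)).
    apply: ler_wpM2l => //.
    by have [_ _ _] := H (j - m); apply; rewrite subr_eq0.
  have h3 : x m * (K * (rho * rho)) = K * Q by rewrite /Q; ring.
  have := ler_wpM2l a0 cj; rewrite mulrDr; case: ifP => _.
    by rewrite (mulrC _ (x j)); lra.
  by rewrite mulr0; lra.
- apply: le_trans (prod_coefS1 n m) _; rewrite iE subrr.
  rewrite add0r in cm.
  have := ler_wpM2l a0 cm; have := ler_wpM2l x0 e0.
  have : x m * (1 + K * (1 * rho ^+ 2)) = x m + K * Q by rewrite /Q; ring.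
  by lra.
- apply: le_trans (prod_coefS2 n 0) _; rewrite iE add0r.
  rewrite add0r in cm.
  have := ler_wpM2l a0 e0; have := ler_wpM2l x0 cm.
  set V := al m * rho ^+ 2.
  have V0 : 0 <= V by rewrite mulr_ge0.
  have KV0 : 0 <= K * V by rewrite mulr_ge0.
  have QV : Q <= V by rewrite /Q /V ler_wpM2r // -ler_sqr ?nnegrE //; have := ab m; lra.
  have : x m * (K * (rho * rho ^+ 2)) <= K * V.
    have -> : x m * (K * (rho * rho ^+ 2)) = K * (rho * Q) by rewrite /Q; ring.
    by rewrite ler_wpM2l // (le_trans _ QV) // ler_piMl.
  have : al m * (1 + K * (1 * rho ^+ 2)) = al m + K * V by rewrite /V; ring.
  by lra.
- move=> j0; apply: le_trans (prod_coefS2 n j) _; rewrite iE.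
  have {ej} ej := ej j0.
  set Z := x m * rho.
  have Z0 : 0 <= Z by rewrite mulr_ge0.
  have KZ0 : 0 <= K * Z by rewrite mulr_ge0.
  have ZK : Z <= K * Z by rewrite ler_peMl.
  have jm : j + m != m by rewrite -[X in _ != X]add0r (inj_eq (addIr m)).
  have [cjm _ _ _] := H (j + m); have {}cjm := cjm jm.
  have {}cj : cabs ((prod_coef a b n).1 (j + m)) <= rho + K * rho.
    apply: le_trans cjm _; apply: lerD; last by rewrite ler_wpM2l // ler_piMr.
    by case: ifP => _ //; rewrite mulr1; exact: x_rho.
  have := ler_wpM2l x0 cj; have := ler_wpM2l a0 ej.
  have : al m * (K * (rho * rho)) <= 2 * (K * Z).
    have : al m * (rho * rho) <= 2 * Z.
      have : x m * (rho * rho) <= Z by rewrite /Z mulrA ler_piMr.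
      have : rho * rho <= Z by rewrite ler_wpM2r.
      have : al m * (rho * rho) <= (1 + x m) * (rho * rho).
        by rewrite ler_wpM2r // mulr_ge0.
      by lra.
    by move=> /(ler_wpM2l K0); rewrite mulrCA; lra.
  have : x m * (rho + K * rho) = Z + K * Z by rewrite /Z; ring.
  by lra.
Qed.

Lemma coef_inv_all n : (n <= N)%N -> coef_inv n (8 ^+ n).
Proof.
elim: n => [|n IH] nN.
  rewrite /coef_inv /X /A /= => j; have r20 := sqr_ge0 rho.
  have r3 : 0 <= 1 * (rho * rho ^+ 2) by rewrite !mulr_ge0.
  rewrite cabs0 add0r; split => //.
  - have -> : cabs (true%:R : R[i]) = 1 by rewrite -[LHS]/(cabs (1%:C : R[i])) cabs_real normr1.
    by rewrite expr0 !mul1r lerDl.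
  - by move=> /negbTE ->; rewrite cabs0 !mulr_ge0.
rewrite exprS; have [nm|nm] := eqVneq (n : nat) m.
  by apply: coef_inv_step_dominant (IH (ltnW nN)) => //; rewrite exprn_ege1 // ler1n.
by apply: coef_inv_step_other (IH (ltnW nN)) => //; rewrite exprn_ege1 // ler1n.
Qed.

(** One large entry cannot act alone: besides the linear term, a coefficient
    consists of monomials with at least two factors bounded by rho. *)
Lemma prod_coef_dominant j :
  cabs ((prod_coef a b N).1 m) <= x m + 8 ^+ N * (x m * rho ^+ 2) /\
  (j != m -> cabs ((prod_coef a b N).1 j) <= x j * al m + 8 ^+ N * (x m * rho ^+ 2)).
Proof.
have [cj cm _ _] := coef_inv_all (leqnn N) j.
by move: cj cm; rewrite /X /A !ltn_ord => cj cm.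
Qed.
End Dominant.
End CoefficientBounds.

(** * Logarithmic and power inequalities *)

Section LogInequalities.
Variable R : realType.
Implicit Types s t u w : R.

Local Notation L u := (ln (1 + u)).

Lemma ln1D_ge0 u : 0 <= u -> 0 <= L u.
Proof. by move=> u0; rewrite ln_ge0 // lerDl. Qed.

Lemma ln1D_gt0 u : 0 < u -> 0 < L u.
Proof. by move=> u0; rewrite ln_gt0 // ltrDl. Qed.

Lemma ler_ln1D u w : 0 <= u -> u <= w -> L u <= L w.
Proof. by move=> u0 uw; rewrite ler_ln ?posrE ?lerD2l //; lra. Qed.

Lemma ln1D_tangent s w : 0 <= s -> 0 <= w -> L w <= L s + (w - s) / (1 + s).
Proof.
move=> s0 w0.
have s1 : 0 < 1 + s by lra.
have w1 : 0 < 1 + w by lra.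
have -> : 1 + w = (1 + s) * (1 + (w - s) / (1 + s)).
  by field; rewrite gt_eqF.
have pos : 0 < 1 + (w - s) / (1 + s).
  have -> : 1 + (w - s) / (1 + s) = (1 + w) / (1 + s) by field; rewrite gt_eqF.
  by rewrite divr_gt0.
rewrite lnM ?posrE // lerD2l le_ln1Dx //; lra.
Qed.

Lemma ln1D_ge_ratio u : 0 <= u -> u / (1 + u) <= L u.
Proof.
move=> u0; have := ln1D_tangent u0 (lexx 0).
by rewrite addr0 ln1 sub0r mulNr; lra.
Qed.

(** Put s = sqrt(1+u).  Since ln s >= 1 - 1/s, (1+u) ln(1+u) - u is at
    least (s-1)^2, and u = (s-1)(s+1) with (s+1)^2 <= 2(2+u). *)
Lemma ln1D_superlin u : 0 <= u -> u ^+ 2 / (2 * (2 + u)) <= (1 + u) * L u - u.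
Proof.
move=> u0; set s := Num.sqrt (1 + u).
have s2 : s ^+ 2 = 1 + u by rewrite sqr_sqrtr //; lra.
have s0 : 0 < s by rewrite sqrtr_gt0; lra.
have s1 : 1 <= s by rewrite -sqrtr1 ler_wsqrtr //; lra.
have Ls : L u = 2 * ln s by rewrite -s2 lnXn // mulr_natl.
have lns : 1 - s^-1 <= ln s.
  have := @ln1D_ge_ratio (s - 1); rewrite subrKC => H.
  have -> : 1 - s^-1 = (s - 1) / s by field; rewrite gt_eqF.
  by apply: H; lra.
have h : (s - 1) ^+ 2 <= (1 + u) * L u - u.
  rewrite Ls -s2.
  have : s ^+ 2 * (2 * (1 - s^-1)) <= s ^+ 2 * (2 * ln s).
    by rewrite ler_wpM2l ?sqr_ge0 // ler_wpM2l.
  have -> : s ^+ 2 * (2 * (1 - s^-1)) = 2 * s ^+ 2 - 2 * s by field; rewrite gt_eqF.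
  by nra.
apply: le_trans h; rewrite ler_pdivrMr; last by lra.
have -> : u = (s - 1) * (s + 1) by nra.
rewrite exprMn ler_wpM2l ?sqr_ge0 //; nra.
Qed.

(** The ratio ln(1+u)/u decreases: (1+u)^(s/u) <= 1 + s by weighted AM-GM. *)
Lemma ln1D_ratio_anti s u : 0 < u -> 0 <= s -> s <= u -> s * L u <= u * L s.
Proof.
move=> u0 s0 su.
have lu : 0 <= s / u <= 1 by rewrite divr_ge0 ?(ltW u0) //= ler_pdivrMr // mul1r.
have /(weighted_amgm lu) /(_ ler01) : 0 <= 1 + u by lra.
rewrite powR1 !mulr1 mulrDr mulr1 divfK ?gt_eqF // => H.
have : ln ((1 + u) `^ (s / u)) <= L s.
  by rewrite ler_ln ?posrE ?powR_gt0 //; lra.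
by rewrite ln_powR mulrAC ler_pdivrMr // (mulrC (L s)).
Qed.

(** In logarithmic coordinates, ln (ln (1 + u e^t)) is concave and c is its slope
    at t = 0; this is the resulting tangent bound. *)
Lemma ln1D_exp_bound (u c t : R) : 0 < u -> c * L u = u / (1 + u) -> 0 <= t ->
  L (u * expR t) <= expR (c * t) * L u.
Proof.
move=> u0 cE t0.
have Lu0 := ln1D_gt0 u0.
have c1 : 1 <= c * (1 + u).
  rewrite -(ler_pM2r Lu0) mul1r mulrAC cE divfK ?gt_eqF //; last by lra.
  by rewrite le_ln1Dx //; lra.
pose phi (y : R) := expR (c * y) * L u - ln (1 + u * expR y).
pose dphi (y : R) := c * expR (c * y) * L u - u * expR y / (1 + u * expR y).
have pos y : 0 < 1 + u * expR y by rewrite addr_gt0 // mulr_gt0 // expR_gt0.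
have dphiP (y : R) : is_derive y (1 : R) phi (dphi y).
  have e1 : is_derive y (1 : R) (fun z : R => c * z) c.
    by apply: (is_derive_eq (is_deriveZ c (is_derive_id y (1 : R)))); rewrite /GRing.scale /= mulr1.
  have e2 := is_derive1_comp (is_derive_expR (c * y)) e1.
  have e3 : is_derive y (1 : R) (fun z : R => 1 + u * expR z) (u * expR y).
    apply: (is_derive_eq (is_deriveD (is_derive_cst (1 : R) y (1 : R))
      (is_deriveZ u (is_derive_expR y)))).
    by rewrite add0r.
  have e4 := @is_derive1_comp _ (@ln R) (fun z => 1 + u * expR z) y _ _ (is_derive1_ln (pos y)) e3.
  have e5 := is_deriveB (is_deriveZ (L u) e2) e4.
  have -> : phi = (L u \*: (@expR R \o (fun z => c * z))) - (@ln R \o (fun z => 1 + u * expR z)).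
    by apply/funext => z; rewrite /phi (mulrC (expR (c * z))).
  apply: (is_derive_eq e5); rewrite /dphi /GRing.scale /=.
  by ring.
have [] := @MVT_segment R phi dphi 0 t t0 (fun y _ => dphiP y).
  by apply: derivable_within_continuous => y _; exact: ex_derive.
move=> z; rewrite in_itv /= subr0 => /andP[z0 zt] E.
suff : 0 <= phi t - phi 0.
  by rewrite /phi mulr0 !expR0 mul1r mulr1 subrr subr0 subr_ge0.
rewrite E mulr_ge0 // /dphi subr_ge0 ler_pdivrMr //.
have -> : c * expR (c * z) * L u = expR (c * z) * (c * L u) by ring.
have -> : expR (c * z) * (c * L u) * (1 + u * expR z)
    = u * ((1 + u)^-1 * (expR (c * z) * (1 + u * expR z))) by rewrite cE; ring.
rewrite ler_pM2l // ler_pdivlMl; last by lra.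
(* (1 + u) e^z <= e^{cz} (1 + u e^z) because the slope c - 1 + uc is nonnegative *)
have -> : expR (c * z) * (1 + u * expR z)
    = expR z * (expR ((c - 1) * z) + u * expR (c * z)).
  have E' : expR ((c - 1) * z) * expR z = expR (c * z).
    by rewrite -expRD; congr expR; ring.
  by rewrite mulrDr mulr1 -{1}E'; ring.
rewrite (mulrC (1 + u)) ler_pM2l ?expR_gt0 //.
have h1 := expR_ge1Dx ((c - 1) * z).
have h2 : u * (1 + c * z) <= u * expR (c * z) by rewrite ler_pM2l // expR_ge1Dx.
have h3 : 0 <= z * (c * (1 + u) - 1) by rewrite mulr_ge0 // subr_ge0.
by lra.
Qed.

(** Bernoulli's inequality for exponents at most 1. *)
Lemma powR_le1D (z r : R) : 0 <= z -> 0 <= r <= 1 -> z `^ r <= 1 + r * (z - 1).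
Proof.
move=> z0 /weighted_amgm /(_ z0 ler01); rewrite powR1; lra.
Qed.

(** Bernoulli's inequality for exponents at least 1, from the one for 1/r. *)
Lemma powR_ge1D (z r : R) : 0 <= z -> 1 <= r -> 1 + r * (z - 1) <= z `^ r.
Proof.
move=> z0 r1.
have r0 : 0 < r by lra.
have rV : 0 <= r^-1 <= 1 by rewrite invr_ge0 (ltW r0) invf_le1.
have := powR_le1D (powR_ge0 z r) rV; rewrite -powRrM divff ?gt_eqF // powRr1 //.
rewrite -(ler_pM2l r0) mulrDr mulrA divff ?gt_eqF // mul1r; lra.
Qed.

Lemma powR_convex (l r x y : R) : 0 <= l <= 1 -> 1 <= r -> 0 <= x -> 0 <= y ->
  (l * x + (1 - l) * y) `^ r <= l * x `^ r + (1 - l) * y `^ r.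
Proof.
move=> /andP[l0 l1] r1 x0 y0; set z := l * x + _.
have lx0 : 0 <= l * x by rewrite mulr_ge0.
have ly0 : 0 <= (1 - l) * y by rewrite mulr_ge0 // subr_ge0.
have [z0|zn0] := eqVneq z 0.
  rewrite z0 powR0; last by rewrite gt_eqF //; lra.
  by rewrite addr_ge0 // mulr_ge0 ?powR_ge0 // subr_ge0.
have zp : 0 < z by rewrite lt_def zn0 addr_ge0.
have tan w : 0 <= w -> z `^ r * (1 + r * (w / z - 1)) <= w `^ r.
  move=> w0; have -> : w `^ r = z `^ r * (w / z) `^ r.
    by rewrite -powRM ?divr_ge0 ?(ltW zp) // mulrC divfK.
  by rewrite ler_wpM2l ?powR_ge0 // powR_ge1D // divr_ge0 // ltW.
have -> : z `^ r = l * (z `^ r * (1 + r * (x / z - 1)))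
    + (1 - l) * (z `^ r * (1 + r * (y / z - 1))).
  have -> : l * (z `^ r * (1 + r * (x / z - 1))) + (1 - l) * (z `^ r * (1 + r * (y / z - 1)))
    = z `^ r * (1 + r * ((l * x + (1 - l) * y) / z - 1)) by ring.
  by rewrite -/z divff // subrr mulr0 addr0 mulr1.
by apply: lerD; rewrite ler_wpM2l ?subr_ge0 ?tan.
Qed.

(** To the right of u^P, the function z |-> ln(1 + z^(1/P))^P lies below its
    tangent at u^P.  Writing
    th for the logarithmic slope of ln(1+u) at u, the ratio of values is at most
    (w/u)^(P th), and Bernoulli's inequality applies since th <= 1. *)
Lemma ln1D_powR_slope (u w P : R) : 0 < u -> u <= w -> 0 < P ->
  L w `^ P <= L u `^ P
    + u / ((1 + u) * L u) * ((L u / u) `^ P * (w `^ P - u `^ P)).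
Proof.
move=> u0 uw P0; set c := u / ((1 + u) * L u).
have Lu0 := ln1D_gt0 u0.
have w0 : 0 < w by lra.
have cE : c * L u = u / (1 + u).
  by rewrite /c; field; rewrite !gt_eqF //; lra.
have c0 : 0 <= c by rewrite divr_ge0 ?mulr_ge0 //; lra.
have c1 : c <= 1.
  by rewrite -(ler_pM2r Lu0) cE mul1r ln1D_ge_ratio // ltW.
have t0 : 0 <= ln (w / u) by rewrite ln_ge0 // ler_pdivlMr // mul1r.
have wE : w = u * expR (ln (w / u)).
  by rewrite lnK ?posrE ?divr_gt0 // mulrC divfK // gt_eqF.
have Lw : L w <= (w / u) `^ c * L u.
  rewrite {1}wE /powR gt_eqF ?divr_gt0 //.
  exact: ln1D_exp_bound.
have z0 : 0 <= (w / u) `^ P by exact: powR_ge0.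
have cc : 0 <= c <= 1 by rewrite c0.
have : L w `^ P <= L u `^ P * (1 + c * ((w / u) `^ P - 1)).
  apply: (@le_trans _ _ (((w / u) `^ c * L u) `^ P)).
    apply: ge0_ler_powR; rewrite ?nnegrE ?(ltW P0) //.
    - by rewrite ln1D_ge0 // ltW.
    - by rewrite mulr_ge0 ?powR_ge0 // ltW.
  rewrite powRM ?powR_ge0 ?(ltW Lu0) // mulrC ler_wpM2l ?powR_ge0 //.
  by rewrite powRAC powR_le1D.
move=> H; apply: le_trans H _; rewrite le_eqVlt; apply/orP; left; apply/eqP.
rewrite mulrDr mulr1; congr (_ + _).
have uP : u `^ P != 0 by rewrite gt_eqF // powR_gt0.
have uV : (u^-1) `^ P = (u `^ P)^-1 by exact: powRV (ltW u0).
have u0' := ltW u0.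
rewrite (powRM P (ltW w0)) ?invr_ge0 // (powRM P (ltW Lu0)) ?invr_ge0 // uV.
by field.
Qed.

(** After normalising the sum to 1, each term is at most its P-th power. *)
Lemma powR_sum_le (I : finType) (f : I -> R) (P : R) : 0 < P <= 1 ->
  (forall i, 0 <= f i) -> (\sum_i f i) `^ P <= \sum_i f i `^ P.
Proof.
move=> /andP[P0 P1] f0; set S := \sum_i f i.
have S0 : 0 <= S by apply: sumr_ge0.
have [->|Sn0] := eqVneq S 0.
  by rewrite powR0 ?gt_eqF // sumr_ge0 // => i _; exact: powR_ge0.
have Sp : 0 < S by rewrite lt_def Sn0.
rewrite -[leLHS]mulr1 -(divff Sn0) /S mulr_suml mulr_sumr -/S.
apply: ler_sum => i _.
have iS : f i <= S by rewrite /S (bigD1 i) //= lerDl sumr_ge0.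
have [->|fi] := eqVneq (f i) 0; first by rewrite mul0r mulr0 powR_ge0.
have fp : 0 < f i by rewrite lt_def fi f0.
have r1 : 0 < f i / S <= 1 by rewrite divr_gt0 //= ler_pdivrMr // mul1r.
have -> : f i `^ P = S `^ P * (f i / S) `^ P.
  by rewrite -powRM ?divr_ge0 // mulrC divfK.
by rewrite ler_wpM2l ?powR_ge0 // ger1_powR.
Qed.
End LogInequalities.

(** * The inequality for the coefficients *)

Section Scalar.
Variable R : realType.
Local Notation L u := (ln (1 + u)).

(** Let M be the L^r mean of v.  The tangent of ln(1+u) at M equals
    ln(1+M) times the convex combination l 1 + (1-l) u/M, and convexity of the
    r-th power bounds its mean by the value at u = M. *)
Lemma jensen_ln1D (d : nat) (r : R) (v : 'I_d -> R) : (0 < d)%N -> 1 <= r ->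
  (forall k, 0 <= v k) ->
  d%:R^-1 * \sum_k L (v k) `^ r
  <= L ((d%:R^-1 * \sum_k v k `^ r) `^ r^-1) `^ r.
Proof.
move=> d0 r1 v0; set A := d%:R^-1 * \sum_k v k `^ r; set M := A `^ r^-1.
have dR : 0 < d%:R :> R by rewrite ltr0n.
have dV : 0 < d%:R^-1 :> R by rewrite invr_gt0.
have r0 : 0 < r by lra.
have A0 : 0 <= A by rewrite mulr_ge0 ?(ltW dV) // sumr_ge0 // => k _; exact: powR_ge0.
have MA : M `^ r = A by rewrite -powRrM mulVf ?gt_eqF // powRr1.
have [M0|Mn0] := eqVneq M 0.
  have v_0 k : v k = 0.
    move: MA; rewrite M0 powR0 ?gt_eqF // => /esym/eqP.
    rewrite mulf_eq0 gt_eqF //= psumr_eq0 => [/allP H|i _]; last exact: powR_ge0.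
    have /H : k \in index_enum 'I_d by rewrite mem_index_enum.
    by rewrite powR_eq0 (gt_eqF r0) andbT => /eqP.
  rewrite M0 big1 ?mulr0 ?powR_ge0 // => k _.
  by rewrite v_0 addr0 ln1 powR0 // gt_eqF.
have Mp : 0 < M by rewrite lt_def Mn0 powR_ge0.
have Sp := ln1D_gt0 Mp; set S := L M in Sp *.
pose l := 1 - M / (1 + M) / S.
have M1 : 0 < 1 + M by lra.
have l01 : 0 <= l <= 1.
  rewrite /l subr_ge0 ler_pdivrMr // mul1r ln1D_ge_ratio ?(ltW Mp) //=.
  by rewrite gerBl !divr_ge0 ?(ltW Sp) ?(ltW Mp) ?(ltW M1).
have bound k : L (v k) `^ r <= S `^ r * (l + (1 - l) * (v k `^ r / A)).
  have -> : l + (1 - l) * (v k `^ r / A) = l * 1 `^ r + (1 - l) * (v k / M) `^ r.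
    rewrite powR1 mulr1 powRM ?invr_ge0 ?(ltW Mp) // -MA.
    by rewrite (powRV _ (ltW Mp)).
  have vM : 0 <= v k / M by rewrite divr_ge0 // ltW.
  have z0 : 0 <= l * 1 + (1 - l) * (v k / M).
    by case/andP: l01 => l0 l1; apply: addr_ge0; apply: mulr_ge0 => //; rewrite subr_ge0.
  apply: (@le_trans _ _ ((S * (l * 1 + (1 - l) * (v k / M))) `^ r)).
    apply: ge0_ler_powR; rewrite ?nnegrE ?(ltW r0) ?ln1D_ge0 //.
      by rewrite mulr_ge0 ?(ltW Sp).
    have -> : S * (l * 1 + (1 - l) * (v k / M)) = S + (v k - M) / (1 + M).
      by rewrite /l; field; rewrite !gt_eqF.
    by rewrite ln1D_tangent // ltW.
  rewrite (powRM _ (ltW Sp) z0).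
  by rewrite ler_wpM2l ?powR_ge0 // powR_convex.
have An0 : A != 0 by rewrite -MA gt_eqF // powR_gt0.
have -> : S `^ r = d%:R^-1 * \sum_k S `^ r * (l + (1 - l) * (v k `^ r / A)).
  rewrite -mulr_sumr big_split /= sumr_const card_ord -mulr_sumr -mulr_suml.
  have -> : \sum_k v k `^ r = d%:R * A by rewrite /A mulrA divff ?mul1r // gt_eqF.
  by rewrite -mulr_natl; field; rewrite An0 gt_eqF.
by rewrite ler_wpM2l ?(ltW dV) //; apply: ler_sum => k _; exact: bound.
Qed.

Lemma powR_le_sqr (p z : R) : p <= 2 -> 1 <= z -> z `^ p <= z ^+ 2.
Proof.
move=> p2 z1; have z0 : 0 <= z by lra.
by rewrite -(powR_mulrn 2 z0); apply: ler_powR.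
Qed.

(** Convexity of the power at the average of t and rho with weights
    1/(1+del) and del/(1+del). *)
Lemma powR_shift (p t rho del : R) : 1 <= p <= 2 -> 0 <= t -> 0 <= rho -> 0 <= del ->
  (t + del * rho) `^ p <= (1 + del) * (t `^ p + del * rho `^ p).
Proof.
move=> /andP[p1 p2] t0 rho0 del0.
have D : 0 < 1 + del by lra.
have l01 : 0 <= (1 + del)^-1 <= 1 by rewrite invr_ge0 (ltW D) invf_le1 // lerDl.
have lE : 1 - (1 + del)^-1 = del / (1 + del) by field; rewrite gt_eqF.
have -> : t + del * rho = (1 + del) * ((1 + del)^-1 * t + (1 - (1 + del)^-1) * rho).
  by rewrite lE; field; rewrite gt_eqF.
rewrite powRM ?(ltW D) //; last first.
  by rewrite lE addr_ge0 // mulr_ge0 // ?divr_ge0 ?invr_ge0 // ltW.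
have D2 : (1 + del) `^ p <= (1 + del) ^+ 2.
  by apply: powR_le_sqr; rewrite // lerDl.
apply: (@le_trans _ _ ((1 + del) ^+ 2 *
   ((1 + del)^-1 * t `^ p + (1 - (1 + del)^-1) * rho `^ p))).
  by apply: ler_pM; rewrite ?powR_ge0 // powR_convex.
by rewrite lE le_eqVlt; apply/orP; left; apply/eqP; field; rewrite gt_eqF.
Qed.

Lemma powR_dominant (p t rho C : R) : 1 <= p <= 2 -> 0 <= t -> 0 <= rho <= 1 -> 0 <= C ->
  (t + C * (t * rho ^+ 2)) `^ p <= t `^ p + (2 * C + C ^+ 2) * (t `^ p * rho ^+ 2).
Proof.
move=> /andP[p1 p2] t0 /andP[rho0 rho1] C0.
have r20 := sqr_ge0 rho.
have r21 : rho ^+ 2 <= 1 by rewrite expr_le1.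
have Cr : 0 <= C * rho ^+ 2 by rewrite mulr_ge0.
have -> : t + C * (t * rho ^+ 2) = t * (1 + C * rho ^+ 2) by ring.
rewrite powRM ?addr_ge0 //.
have D2 : (1 + C * rho ^+ 2) `^ p <= (1 + C * rho ^+ 2) ^+ 2.
  by apply: powR_le_sqr; rewrite // lerDl.
have D3 : (1 + C * rho ^+ 2) ^+ 2 <= 1 + (2 * C + C ^+ 2) * rho ^+ 2.
  have : C ^+ 2 * (rho ^+ 2 * rho ^+ 2) <= C ^+ 2 * rho ^+ 2.
    by rewrite ler_wpM2l ?sqr_ge0 // ler_piMl.
  have -> : (1 + C * rho ^+ 2) ^+ 2 = 1 + 2 * (C * rho ^+ 2) + C ^+ 2 * (rho ^+ 2 * rho ^+ 2).
    by ring.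
  by lra.
have := ler_wpM2l (powR_ge0 t p) (le_trans D2 D3); lra.
Qed.

Section Cases.
Variables (I : finType) (x c : I -> R) (m i0 : I) (p a C K : R).
Hypotheses (p1 : 1 < p) (p2 : p <= 2) (x0 : forall j, 0 <= x j)
  (c0 : forall j, 0 <= c j) (mi0 : i0 != m) (C0 : 0 <= C) (K0 : 0 < K).
Local Notation rho := (x i0).
Local Notation nI := (#|I|%:R : R).
Hypotheses (x_rho : forall j, j != m -> x j <= rho) (rho_xm : rho <= x m).
Let Rest := \sum_(j | j != m) x j `^ p.
Let S := \sum_j c j `^ p.
Let P := p / 2.
Let p12 : 1 <= p <= 2. Proof. by rewrite (ltW p1). Qed.
Let P0 : 0 < P. Proof. by rewrite divr_gt0 //; move: p1; lra. Qed.
Let P1 : P <= 1. Proof. by rewrite /P; move: p2; lra. Qed.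
Let p0 : 0 < p. Proof. by move: p1; lra. Qed.
Let rho0 : 0 <= rho. Proof. exact: x0. Qed.
Let C1 := 2 * C + C ^+ 2.
Let C10 : 0 <= C1. Proof. by rewrite addr_ge0 ?sqr_ge0 // mulr_ge0. Qed.

Lemma powR_rho_le_rest : rho `^ p <= Rest.
Proof.
rewrite /Rest (bigD1 i0) //= lerDl sumr_ge0 // => j _; exact: powR_ge0.
Qed.

(** The coefficient at m is handled by a relative error C rho^2; the others
    are compared with the rest of the vector, whose p-th power sum is at least
    rho^p because rho itself is one of its entries. *)
Lemma sum_powR_dominant (del : R) : 0 <= del -> 0 <= a -> rho <= 1 ->
  c m <= x m + C * (x m * rho ^+ 2) ->
  (forall j, j != m -> c j <= a * (x j + del * rho)) ->
  S <= x m `^ p + C1 * (x m `^ p * rho ^+ 2) + a `^ p * ((1 + del) * (1 + nI * del)) * Rest.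
Proof.
move=> del0 a0 rho1 cm cj.
rewrite /S (bigD1 m) //=; apply: lerD.
  apply: le_trans (powR_dominant p12 (x0 m) _ C0); last by rewrite rho0.
  by apply: ge0_ler_powR; rewrite ?nnegrE ?(ltW p0) // addr_ge0 ?mulr_ge0 ?sqr_ge0.
apply: (@le_trans _ _ (\sum_(j | j != m) a `^ p * ((1 + del) * (x j `^ p + del * rho `^ p)))).
  apply: ler_sum => j jm.
  apply: (@le_trans _ _ ((a * (x j + del * rho)) `^ p)).
    by apply: ge0_ler_powR; rewrite ?nnegrE ?(ltW p0) ?cj // mulr_ge0 // addr_ge0 // mulr_ge0.
  rewrite powRM //; last by rewrite addr_ge0 // mulr_ge0.
  by rewrite ler_wpM2l ?powR_ge0 // powR_shift.
rewrite -!mulr_sumr big_split /= -/Rest -!mulrA ler_wpM2l ?powR_ge0 //.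
rewrite ler_wpM2l ?addr_ge0 // mulrDl mul1r lerD2l.
rewrite sumr_const -[_ *+ _]mulr_natl -mulrA; apply: ler_pM.
- by rewrite ler0n.
- by rewrite mulr_ge0 // powR_ge0.
- by rewrite ler_nat max_card.
- by rewrite ler_wpM2l // powR_rho_le_rest.
Qed.

(** The tangent bound in the variable S = |c|_p^p, at the point where the
    coefficients reduce to the single entry x_m.  There is growth to pay for only
    beyond that point. *)
Lemma ln_bound_slope : 0 < x m ->
  S <= x m `^ p \/
  L (K * S `^ (2 / p)) `^ P <= L (K * x m ^+ 2) `^ P +
    K * x m ^+ 2 / ((1 + K * x m ^+ 2) * L (K * x m ^+ 2)) *
    ((L (K * x m ^+ 2) / (K * x m ^+ 2)) `^ P * (K `^ P * (S - x m `^ p))).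
Proof.
move=> xm0; have [le|lt] := leP S (x m `^ p); [by left|right].
have S0 : 0 <= S by apply: sumr_ge0 => j _; exact: powR_ge0.
have u0 : 0 < K * x m ^+ 2 by rewrite mulr_gt0 // exprn_gt0.
have x2 : x m ^+ 2 = (x m `^ p) `^ (2 / p).
  by rewrite -powRrM mulrC divfK ?gt_eqF // powR_mulrn.
have uw : K * x m ^+ 2 <= K * S `^ (2 / p).
  rewrite ler_pM2l // x2; apply: ge0_ler_powR; rewrite ?nnegrE ?powR_ge0 ?(ltW lt) //.
  by rewrite divr_ge0 // ltW.
have := ln1D_powR_slope u0 uw P0.
have wP : (K * S `^ (2 / p)) `^ P = K `^ P * S.
  rewrite powRM ?powR_ge0 ?(ltW K0) // -powRrM; congr (_ * _).
  by rewrite (_ : 2 / p * P = 1) ?powRr1 // /P; field; rewrite gt_eqF.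
have uP : (K * x m ^+ 2) `^ P = K `^ P * x m `^ p.
  rewrite powRM ?sqr_ge0 ?(ltW K0) // -powR_mulrn // -powRrM; congr (_ * _ `^ _).
  by rewrite /P; field.
by rewrite wP uP -mulrBr.
Qed.

Let sumL_ge0 : 0 <= \sum_(j | j != m) L (K * x j ^+ 2) `^ P.
Proof. by apply: sumr_ge0 => j _; exact: powR_ge0. Qed.

Lemma ln_bound_no_growth : S <= x m `^ p ->
  L (K * S `^ (2 / p)) `^ P <= \sum_j L (K * x j ^+ 2) `^ P.
Proof.
move=> le; have S0 : 0 <= S by apply: sumr_ge0 => j _; exact: powR_ge0.
have x2 : x m ^+ 2 = (x m `^ p) `^ (2 / p).
  by rewrite -powRrM mulrC divfK ?gt_eqF // powR_mulrn.
have KS0 : 0 <= K * S `^ (2 / p) by rewrite mulr_ge0 ?powR_ge0 ?(ltW K0).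
rewrite (bigD1 m) //= -[leLHS]addr0; apply: lerD => //.
apply: ge0_ler_powR; rewrite ?nnegrE ?ln1D_ge0 ?(ltW P0) ?mulr_ge0 ?sqr_ge0 ?(ltW K0) ?powR_ge0 //.
apply: ler_ln1D => //; rewrite ler_pM2l // x2; apply: ge0_ler_powR; rewrite ?nnegrE ?powR_ge0 //.
by rewrite divr_ge0 // ltW.
Qed.

(** Here S - x_m^p <= (1 + C2 x_m^2) sum_{j<>m} x_j^p, and the relative error
    is absorbed by the factor th of the slope at u = K x_m^2.  The ratio
    ln(1+u)/u decreases, so each remaining term has at least the slope
    ln(1+u)/u. *)
Lemma ln_bound_max_le1 (C2 : R) : 0 < x m -> x m <= 1 -> a ^+ 2 = 1 + x m ^+ 2 -> 1 <= a ->
  2 * (1 + C) * (1 + nI * C) + C1 <= C2 ->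
  (forall u, 0 < u -> u <= K -> u + C2 * u ^+ 2 / K <= (1 + u) * L u) ->
  c m <= x m + C * (x m * rho ^+ 2) ->
  (forall j, j != m -> c j <= x j * a + C * (x m * rho ^+ 2)) ->
  L (K * S `^ (2 / p)) `^ P <= \sum_j L (K * x j ^+ 2) `^ P.
Proof.
move=> xm0 xm1 aE a1 HC2 HK cm cj.
have [/ln_bound_no_growth //|H] := ln_bound_slope xm0.
apply: le_trans H _.
set y := x m ^+ 2 in aE HK *; set u := K * y.
have y0 : 0 < y by rewrite exprn_gt0.
have y1 : y <= 1 by rewrite expr_le1.
have u0 : 0 < u by rewrite mulr_gt0.
have uK : u <= K by rewrite ler_piMr ?(ltW K0).
have Lu := ln1D_gt0 u0.
have rho1 : rho <= 1 by exact: le_trans rho_xm xm1.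
have del0 : 0 <= C * y by rewrite mulr_ge0 // ltW.
have a0 : 0 <= a by lra.
have cj' j : j != m -> c j <= a * (x j + C * y * rho).
  move=> jm; apply: le_trans (cj j jm) _; rewrite mulrDr mulrC lerD2l.
  apply: (@le_trans _ _ (C * y * rho)).
    rewrite -(mulrA C) ler_wpM2l // /y !expr2 mulrA ler_wpM2r //.
    by rewrite ler_wpM2l // ltW.
  by rewrite ler_peMl // mulr_ge0.
have := sum_powR_dominant del0 a0 rho1 cm cj'.
have n0 : 0 <= nI by [].
have R0 : 0 <= Rest by apply: le_trans powR_rho_le_rest; exact: powR_ge0.
have top : x m `^ p * rho ^+ 2 <= y * Rest.
  apply: (@le_trans _ _ (y * rho `^ p)); last by rewrite ler_wpM2l ?(ltW y0) ?powR_rho_le_rest.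
  have [->|rn0] := eqVneq rho 0.
    by rewrite expr0n /= mulr0 mulr_ge0 ?(ltW y0) ?powR_ge0.
  rewrite /y -!powR_mulrn //.
  have -> : rho `^ 2%:R = rho `^ (2 - p) * rho `^ p.
    by rewrite -powRD ?rn0 ?implybT // subrK.
  have -> : x m `^ 2%:R = x m `^ p * x m `^ (2 - p).
    by rewrite -powRD ?gt_eqF ?implybT // addrC subrK.
  rewrite mulrA ler_wpM2r ?powR_ge0 // ler_wpM2l ?powR_ge0 //.
  by apply: ge0_ler_powR; rewrite ?nnegrE //; move: p2; lra.
have coef : a `^ p * ((1 + C * y) * (1 + nI * (C * y))) <= 1 + 2 * (1 + C) * (1 + nI * C) * y.
  have ap : a `^ p <= 1 + y.
    by rewrite -aE powR_le_sqr.
  apply: (@le_trans _ _ ((1 + y) * ((1 + C * y) * (1 + nI * (C * y))))).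
    by rewrite ler_wpM2r // mulr_ge0 ?addr_ge0 // mulr_ge0.
  set g := nI * C; have g0 : 0 <= g by rewrite mulr_ge0.
  have -> : nI * (C * y) = g * y by rewrite /g mulrA.
  have yy : y * y <= y by rewrite ler_piMl // ltW.
  have yyy : y * y * y <= y by rewrite (le_trans _ yy) // ler_piMr // mulr_ge0 // ltW.
  have Cg : 0 <= C * g by rewrite mulr_ge0.
  have := ler_wpM2l Cg yyy; have := ler_wpM2l Cg yy.
  have := ler_wpM2l C0 yy; have := ler_wpM2l g0 yy.
  have := ltW y0; have := mulr_ge0 C0 (ltW y0); have := mulr_ge0 g0 (ltW y0).
  have := mulr_ge0 Cg (ltW y0).
  have -> : (1 + y) * ((1 + C * y) * (1 + g * y)) = 1 + y + C * y + g * y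
    + C * g * (y * y) + C * (y * y) + g * (y * y) + C * g * (y * y * y) by ring.
  have -> : 1 + 2 * (1 + C) * (1 + g) * y = 1 + 2 * y + 2 * (C * y) + 2 * (g * y)
    + 2 * (C * g * y) by ring.
  by lra.
move=> Sb.
have T : S - x m `^ p <= (1 + C2 * y) * Rest.
  have := ler_wpM2l C10 top; have := ler_wpM2r R0 coef.
  have := ler_wpM2r (mulr_ge0 (ltW y0) R0) HC2.
  have -> : (1 + C2 * y) * Rest = Rest + C2 * (y * Rest) by ring.
  by move: Sb; lra.
set th := u / _.
have th0 : 0 <= th by rewrite divr_ge0 ?(ltW u0) // mulr_ge0 ?(ltW Lu) //; lra.
have thC : th * (1 + C2 * y) <= 1.
  rewrite /th mulrAC ler_pdivrMr ?mul1r; last by rewrite mulr_gt0 //; lra.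
  apply: le_trans (HK u u0 uK); rewrite mulrDr mulr1 lerD2l.
  by rewrite le_eqVlt; apply/orP; left; apply/eqP; rewrite /u; field; rewrite gt_eqF.
have Lterm j : j != m -> (L u / u) `^ P * (K `^ P * x j `^ p) <= L (K * x j ^+ 2) `^ P.
  move=> jm.
  have -> : K `^ P * x j `^ p = (K * x j ^+ 2) `^ P.
    rewrite powRM ?sqr_ge0 ?(ltW K0) // -powR_mulrn // -powRrM; congr (_ * _ `^ _).
    by rewrite /P; field.
  have Kx0 : 0 <= K * x j ^+ 2 by rewrite mulr_ge0 ?sqr_ge0 ?(ltW K0).
  rewrite -powRM ?divr_ge0 ?(ltW Lu) ?(ltW u0) //.
  apply: ge0_ler_powR; rewrite ?nnegrE ?ln1D_ge0 ?(ltW P0) //.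
    by rewrite mulr_ge0 // divr_ge0 ?(ltW Lu) ?(ltW u0).
  rewrite mulrAC ler_pdivrMr // mulrC (mulrC (L _)) ln1D_ratio_anti //.
  rewrite ler_pM2l // ler_sqr ?nnegrE //.
  exact: le_trans (x_rho jm) rho_xm.
rewrite (bigD1 m) //= lerD2l.
apply: (@le_trans _ _ ((L u / u) `^ P * (K `^ P * Rest))); last first.
  rewrite /Rest !mulr_sumr; apply: ler_sum => j jm; exact: Lterm.
have A0 : 0 <= (L u / u) `^ P * K `^ P by rewrite mulr_ge0 ?powR_ge0.
have thT : th * (S - x m `^ p) <= Rest.
  apply: (@le_trans _ _ (th * ((1 + C2 * y) * Rest))); first by rewrite ler_wpM2l.
  by rewrite mulrA ler_piMl.
have := ler_wpM2l A0 thT.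
by congr (_ <= _); ring.
Qed.

(** Now S - x_m^p <= C4 x_m^p sum_{j<>m} x_j^p.  The factor x_m^p cancels
    against the slope, which decays like u^(-P); since x_j <= 1, each remaining
    term is at least ln(1+K)^P x_j^p, and ln(1+K)^P >= C4. *)
Lemma ln_bound_max_ge1 (C4 : R) : 1 <= x m -> rho <= 1 -> a ^+ 2 = 1 + x m ^+ 2 -> 0 <= a ->
  4 * (1 + C) * (1 + nI * C) + C1 <= C4 -> 1 <= C4 -> C4 ^+ 2 <= L K ->
  c m <= x m + C * (x m * rho ^+ 2) ->
  (forall j, j != m -> c j <= x j * a + C * (x m * rho ^+ 2)) ->
  L (K * S `^ (2 / p)) `^ P <= \sum_j L (K * x j ^+ 2) `^ P.
Proof.
move=> xm1 rho1 aE a0 HC4 C41 HL cm cj.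
have xm0 : 0 < x m by lra.
have [/ln_bound_no_growth //|H] := ln_bound_slope xm0.
apply: le_trans H _.
set u := K * x m ^+ 2.
have u0 : 0 < u by rewrite mulr_gt0 // exprn_gt0.
have Lu := ln1D_gt0 u0.
have uK : K <= u by rewrite ler_peMr ?(ltW K0) // exprn_ege1.
have xa : x m <= a.
  by rewrite -ler_sqr ?nnegrE // aE; lra.
have a2x : a <= 2 * x m.
  rewrite -ler_sqr ?nnegrE ?mulr_ge0 // aE exprMn.
  have : 1 <= x m ^+ 2 by rewrite exprn_ege1.
  by lra.
have n0 : 0 <= nI by [].
have R0 : 0 <= Rest by apply: le_trans powR_rho_le_rest; exact: powR_ge0.
have cj' j : j != m -> c j <= a * (x j + C * rho).
  move=> jm; apply: le_trans (cj j jm) _; rewrite mulrDr mulrC lerD2l.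
  rewrite (mulrCA a) ler_wpM2l //; apply: ler_pM => //; first by rewrite sqr_ge0.
  by rewrite expr2 ler_piMl.
have := sum_powR_dominant C0 a0 rho1 cm cj'.
set xp := x m `^ p.
have xp0 : 0 <= xp by exact: powR_ge0.
have ap : a `^ p <= 4 * xp.
  apply: (@le_trans _ _ ((2 * x m) `^ p)).
    by apply: ge0_ler_powR; rewrite ?nnegrE ?(ltW p0) ?mulr_ge0.
  rewrite powRM // ler_wpM2r //.
  apply: (@le_trans _ _ (2 `^ 2)); first by apply: ler_powR; rewrite // ler1n.
  by rewrite -[X in _ `^ X]/(2%:R) powR_mulrn //; lra.
have top : rho ^+ 2 <= Rest.
  apply: le_trans powR_rho_le_rest; have [->|rn0] := eqVneq rho 0.
    by rewrite expr0n /= powR_ge0.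
  rewrite -powR_mulrn //; apply: ger_powR => //.
  by rewrite rho1 lt_def rn0 rho0.
move=> Sb.
have T : S - xp <= C4 * (xp * Rest).
  have g0 : 0 <= (1 + C) * (1 + nI * C) * Rest.
    by rewrite !mulr_ge0 // addr_ge0 // mulr_ge0.
  have := ler_wpM2r g0 ap.
  have := ler_wpM2l C10 (ler_wpM2l xp0 top).
  have := ler_wpM2r (mulr_ge0 xp0 R0) HC4.
  have -> : a `^ p * ((1 + C) * (1 + nI * C) * Rest) = a `^ p * ((1 + C) * (1 + nI * C)) * Rest.
    by ring.
  have -> : 4 * xp * ((1 + C) * (1 + nI * C) * Rest) =
     4 * (1 + C) * (1 + nI * C) * (xp * Rest) by ring.
  by move: Sb; lra.
have LK1 : 1 <= L K by apply: le_trans HL; rewrite exprn_ege1.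
have Lu1 : 1 <= L u by apply: le_trans LK1 _; rewrite ler_ln1D // ltW.
set th := u / _.
have th0 : 0 <= th by rewrite divr_ge0 ?(ltW u0) // mulr_ge0 ?(ltW Lu) //; lra.
have thL : th * L u `^ P <= 1.
  have thLu : th * L u <= 1.
    rewrite /th mulrAC ler_pdivrMr ?mul1r; last by rewrite mulr_gt0 //; lra.
    by rewrite ler_wpM2r ?(ltW Lu) //; lra.
  by apply: le_trans thLu; rewrite ler_wpM2l // ler1_powR.
have uP : u `^ P = K `^ P * xp.
  rewrite powRM ?sqr_ge0 ?(ltW K0) // -powR_mulrn // -powRrM; congr (_ * _ `^ _).
  by rewrite /P; field.
have LKP : C4 <= L K `^ P.
  have C40 : 0 <= C4 by lra.
  have -> : C4 = (C4 ^+ 2) `^ 2^-1.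
    by rewrite -powR_mulrn // -powRrM divff // powRr1.
  apply: (@le_trans _ _ (L K `^ 2^-1)).
    apply: ge0_ler_powR; rewrite ?nnegrE ?sqr_ge0 ?invr_ge0 //.
    by apply: le_trans HL; exact: sqr_ge0.
  by apply: ler_powR => //; rewrite /P; move: p1; lra.
have Lterm j : j != m -> C4 * x j `^ p <= L (K * x j ^+ 2) `^ P.
  move=> jm.
  have xj1 : x j <= 1 by exact: le_trans (x_rho jm) rho1.
  have Kx0 : 0 <= K * x j ^+ 2 by rewrite mulr_ge0 ?sqr_ge0 ?(ltW K0).
  apply: (@le_trans _ _ (L K `^ P * x j `^ p)); first by rewrite ler_wpM2r ?powR_ge0.
  have -> : x j `^ p = (x j ^+ 2) `^ P.
    by rewrite -powR_mulrn // -powRrM; congr (_ `^ _); rewrite /P; field.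
  rewrite -powRM ?sqr_ge0 //; last by lra.
  apply: ge0_ler_powR; rewrite ?nnegrE ?ln1D_ge0 ?(ltW P0) //.
    by rewrite mulr_ge0 ?sqr_ge0 //; lra.
  have KxK : K * x j ^+ 2 <= K by rewrite ler_piMr ?(ltW K0) // expr_le1.
  have := ln1D_ratio_anti K0 Kx0 KxK.
  by rewrite -mulrA ler_pM2l // mulrC.
rewrite (bigD1 m) //= lerD2l.
apply: (@le_trans _ _ (C4 * Rest)); last first.
  rewrite /Rest mulr_sumr; apply: ler_sum => j jm; exact: Lterm.
have uV : (L u / u) `^ P = L u `^ P / u `^ P.
  rewrite powRM ?(ltW Lu) ?invr_ge0 ?(ltW u0) //; congr (_ * _).
  exact: powRV (ltW u0).
have KP0 : 0 <= K `^ P by exact: powR_ge0.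
rewrite uV.
apply: (@le_trans _ _ (th * (L u `^ P / u `^ P * (K `^ P * (C4 * (xp * Rest)))))).
  rewrite ler_wpM2l // ler_wpM2l ?divr_ge0 ?powR_ge0 //.
  by rewrite ler_wpM2l.
have -> : th * (L u `^ P / u `^ P * (K `^ P * (C4 * (xp * Rest)))) =
   (th * L u `^ P) * (C4 * Rest) * (K `^ P * xp / u `^ P) by ring.
rewrite -uP divff ?gt_eqF ?powR_gt0 // mulr1 ler_piMl //.
by rewrite mulr_ge0 //; lra.
Qed.

(** The bound reduces to 1 + K S^(2/p) <= prod (1 + K x_l^2).  Two entries are
    at least 1 and each contributes a factor (K/2)(1 + x^2); the resulting K^2/4
    beats K times the constant of the crude bound.  Subadditivity of the power
    P <= 1 of the sum of the logarithms concludes. *)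
Lemma ln_bound_two_ge1 (B : R) : 1 <= rho -> 1 <= B -> 4 * (nI ^+ 2 * B + 1) <= K ->
  (forall j, c j ^+ 2 <= B * \prod_l (1 + x l ^+ 2)) ->
  L (K * S `^ (2 / p)) `^ P <= \sum_j L (K * x j ^+ 2) `^ P.
Proof.
move=> rho1 B1 HK cB.
set Q := \prod_l (1 + x l ^+ 2) in cB.
have S0 : 0 <= S by apply: sumr_ge0 => j _; exact: powR_ge0.
have KS0 : 0 <= K * S `^ (2 / p) by rewrite mulr_ge0 ?powR_ge0 ?(ltW K0).
have n1 : 1 <= nI by rewrite ler1n; apply/card_gt0P; exists m.
have n0 : 0 <= nI by [].
have Q1 : 1 <= Q.
  rewrite /Q; elim/big_rec: _ => [|j y _ y1] //.
  by rewrite -[X in X <= _]mulr1; apply: ler_pM => //; rewrite lerDl sqr_ge0.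
have BQ0 : 0 <= B * Q by rewrite mulr_ge0 //; lra.
have tp0 : 0 <= 2 / p by rewrite divr_ge0 // ltW.
have SB : S `^ (2 / p) <= nI ^+ 2 * (B * Q).
  have cp j : c j `^ p <= (B * Q) `^ P.
    have -> : c j `^ p = (c j ^+ 2) `^ P.
      by rewrite -powR_mulrn // -powRrM; congr (_ `^ _); rewrite /P; field.
    by apply: ge0_ler_powR; rewrite ?nnegrE ?sqr_ge0 ?(ltW P0).
  have SS : S <= nI * (B * Q) `^ P.
    apply: (@le_trans _ _ (\sum_(j : I) (B * Q) `^ P)); first exact: ler_sum.
    by rewrite sumr_const mulr_natl.
  apply: (@le_trans _ _ ((nI * (B * Q) `^ P) `^ (2 / p))).
    by apply: ge0_ler_powR; rewrite ?nnegrE // mulr_ge0 ?powR_ge0.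
  rewrite powRM ?powR_ge0 // -powRrM.
  rewrite (_ : P * (2 / p) = 1) ?powRr1 //; last by rewrite /P; field; rewrite gt_eqF.
  rewrite ler_wpM2r // -powR_mulrn //; apply: ler_powR => //.
  by rewrite ler_pdivrMr //; move: p1; lra.
have prodK : 1 + K * S `^ (2 / p) <= \prod_l (1 + K * x l ^+ 2).
  have im : m != i0 by rewrite eq_sym.
  have K1 : 1 <= K.
    apply: le_trans HK; have : 0 <= nI ^+ 2 * B by rewrite mulr_ge0 ?sqr_ge0 //; lra.
    by lra.
  have QE : Q = (1 + x m ^+ 2) *
      ((1 + rho ^+ 2) * \prod_(l | (l != m) && (l != i0)) (1 + x l ^+ 2)).
    by rewrite /Q (bigD1 m) //= (bigD1 i0).
  have two (t : R) : 1 <= t -> K / 2 * (1 + t ^+ 2) <= 1 + K * t ^+ 2.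
    move=> t1; have : 1 <= t ^+ 2 by rewrite exprn_ege1.
    have := ltW K0 => K0'; move=> /(ler_wpM2l K0').
    by lra.
  have half0 : 0 <= K / 2 by rewrite divr_ge0 // ltW.
  have sq0 t : 0 <= 1 + t ^+ 2 :> R by rewrite addr_ge0 ?sqr_ge0.
  set q := \prod_(l | (l != m) && (l != i0)) (1 + x l ^+ 2) in QE *.
  have q0 : 0 <= q by apply: prodr_ge0.
  rewrite (bigD1 m) //= (bigD1 i0) //=.
  apply: (@le_trans _ _ (K / 2 * (1 + x m ^+ 2) * (K / 2 * (1 + rho ^+ 2) * q))).
    have -> : K / 2 * (1 + x m ^+ 2) * (K / 2 * (1 + rho ^+ 2) * q) = K * (K / 4) * Q.
      by rewrite QE; field.
    have h1 : K * S `^ (2 / p) <= K * (nI ^+ 2 * (B * Q)) by rewrite ler_wpM2l // ltW.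
    have h2 : K * Q * (nI ^+ 2 * B + 1) <= K * Q * (K / 4).
      by rewrite ler_wpM2l ?mulr_ge0 ?(ltW K0) //; lra.
    have h3 : 1 <= K * Q by rewrite -[1]mulr1 ler_pM.
    have -> : K * (K / 4) * Q = K * Q * (K / 4) by ring.
    have h4 : K * Q * (nI ^+ 2 * B + 1) = K * (nI ^+ 2 * (B * Q)) + K * Q by ring.
    by lra.
  apply: ler_pM; [by rewrite mulr_ge0|by rewrite mulr_ge0 // mulr_ge0| |].
    by apply: two; exact: le_trans rho_xm.
  apply: ler_pM => //; [by rewrite mulr_ge0|exact: two|].
  apply: ler_prod => l _; rewrite sq0 /= lerD2l ler_peMl ?sqr_ge0 //.
apply: (@le_trans _ _ ((\sum_j L (K * x j ^+ 2)) `^ P)); last first.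
  by apply: powR_sum_le => [|j]; rewrite ?P0 // ln1D_ge0 // mulr_ge0 ?sqr_ge0 ?(ltW K0).
have pos j : 0 < 1 + K * x j ^+ 2.
  have : 0 <= K * x j ^+ 2 by rewrite mulr_ge0 ?sqr_ge0 ?(ltW K0).
  by lra.
apply: ge0_ler_powR; rewrite ?nnegrE ?(ltW P0) ?ln1D_ge0 //.
  by apply: sumr_ge0 => j _; rewrite ln1D_ge0 // mulr_ge0 ?sqr_ge0 ?(ltW K0).
have -> : \sum_j L (K * x j ^+ 2) = ln (\prod_l (1 + K * x l ^+ 2)).
  suff [] : 0 < \prod_l (1 + K * x l ^+ 2) /\
    \sum_j L (K * x j ^+ 2) = ln (\prod_l (1 + K * x l ^+ 2)) by [].
  apply: (big_ind2 (fun z y => 0 < y /\ z = ln y)) => [|z y z' y' [y0 ->] [y0' ->]|j _].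
  - by rewrite ln1.
  - by rewrite mulr_gt0 // lnM.
  - by [].
by rewrite ler_ln ?posrE //; [lra|exact: prodr_gt0].
Qed.
End Cases.
End Scalar.

(** * Choice of the parameter and conclusion *)

(** For u small against K/C2 this is the quadratic gain of (1+u) ln(1+u) over
    u; beyond that, ln(1+u) >= 1 + C2 and u^2/K <= u. *)
Lemma ln1D_gain (R : realType) (C2 K u : R) : 0 < C2 ->
  2 * C2 * (1 + expR (1 + C2)) <= K -> 0 < u -> u <= K ->
  u + C2 * u ^+ 2 / K <= (1 + u) * ln (1 + u).
Proof.
move=> C20 HK u0 uK; have K0 : 0 < K by exact: lt_le_trans uK.
have [small|big] := leP (2 * C2 * (2 + u)) K.
  have := ln1D_superlin (ltW u0).
  have : C2 * u ^+ 2 / K <= u ^+ 2 / (2 * (2 + u)).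
    rewrite ler_pdivrMr // mulrAC ler_pdivlMr; last by lra.
    rewrite mulrC mulrCA mulrC -!mulrA.
    have := ler_wpM2l (sqr_ge0 u) small.
    by congr (_ <= _); ring.
  by lra.
have e1 : expR (1 + C2) <= 1 + u.
  have : 2 * C2 * (1 + expR (1 + C2)) < 2 * C2 * (2 + u) by exact: le_lt_trans big.
  by rewrite ltr_pM2l ?mulr_gt0 //; lra.
have L1 : 1 + C2 <= ln (1 + u).
  by rewrite -[leLHS]expRK ler_ln ?posrE ?expR_gt0 //; lra.
have : C2 * u ^+ 2 / K <= C2 * u.
  by rewrite ler_pdivrMr // expr2 -!mulrA ler_wpM2l ?(ltW C20) // ler_wpM2l // ltW.
have : (1 + u) * (1 + C2) <= (1 + u) * ln (1 + u) by rewrite ler_wpM2l //; lra.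
by lra.
Qed.

Lemma exists_argmax (R : realType) (I : finType) (D : pred I) (f : I -> R) (i0 : I) :
  D i0 -> exists2 m, D m & forall j, D j -> f j <= f m.
Proof.
by move=> Di0; case: (arg_maxP f Di0) => m Dm fm; exists m.
Qed.

Section Assembly.
Variables (R : realType) (d : nat).
Hypothesis d_gt0 : (0 < d)%N.
Local Notation N := d.+1.

(** C is the constant of the coefficient bounds after all factors; C1 comes
   from the dominant coefficient, and C2, C4 collect the relative errors when the
   largest entry is at most 1, respectively at least 1. *)
Let C : R := 8 ^+ N.
Let C1 := 2 * C + C ^+ 2.
Let C2 := 2 * (1 + C) * (1 + N%:R * C) + C1.
Let C4 := 4 * (1 + C) * (1 + N%:R * C) + C1.
Let B4 : R := 4 ^+ N.
(** The three summands serve in turn two entries at least 1, all entries at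
    most 1, and a single entry at least 1. *)
Definition beta_scale : R :=
  4 * (N%:R ^+ 2 * B4 + 1) + 2 * C2 * (1 + expR (1 + C2)) + expR (C4 ^+ 2).

Let C_ge1 : 1 <= C. Proof. by rewrite exprn_ege1 // ler1n. Qed.
Let C1_ge0 : 0 <= C1. Proof. by rewrite /C1 addr_ge0 ?sqr_ge0 // mulr_ge0 //; move: C_ge1; lra. Qed.
Let CN : 1 <= (1 + C) * (1 + N%:R * C).
Proof.
have NC : 0 <= N%:R * C by rewrite mulr_ge0 //; move: C_ge1; lra.
by rewrite -[leLHS]mulr1 ler_pM //; move: C_ge1; lra.
Qed.
Let C2_gt0 : 0 < C2.
Proof. by rewrite /C2 -mulrA; move: CN C1_ge0; lra. Qed.
Let C4_ge1 : 1 <= C4.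
Proof. by rewrite /C4 -mulrA; move: CN C1_ge0; lra. Qed.

Let t1 : 0 <= N%:R ^+ 2 * B4. Proof. by rewrite mulr_ge0 ?sqr_ge0 // exprn_ge0. Qed.
Let t2 : 0 <= 2 * C2 * (1 + expR (1 + C2)).
Proof. by rewrite !mulr_ge0 ?(ltW C2_gt0) // addr_ge0 // expR_ge0. Qed.
Let t3 : 0 <= expR (C4 ^+ 2). Proof. exact: expR_ge0. Qed.

Lemma beta_scale_ge1 : 1 <= beta_scale.
Proof. by rewrite /beta_scale; move: t1 t2 t3; lra. Qed.
Let K0 : 0 < beta_scale. Proof. by move: beta_scale_ge1; lra. Qed.

Lemma prod_coef_ln_bound (a b : 'I_N -> R[i]) (p : R) : 1 < p -> p <= 2 ->
  (forall j, cabs (a j) ^+ 2 - cabs (b j) ^+ 2 = 1) ->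
  ln (1 + beta_scale * (\sum_j cabs ((prod_coef a b N).1 j) `^ p) `^ (2 / p)) `^ (p / 2)
  <= \sum_j ln (1 + beta_scale * cabs (b j) ^+ 2) `^ (p / 2).
Proof.
move=> p1 p2 ab.
pose x j := cabs (b j); pose c j := cabs ((prod_coef a b N).1 j).
have x0 j : 0 <= x j by exact: cabs_ge0.
have c0 j : 0 <= c j by exact: cabs_ge0.
have [m _ xm] := @exists_argmax R 'I_N predT x ord0 isT.
(* At least two factors are present, so there is a second largest entry. *)
have [i1 i1m] : exists i1 : 'I_N, i1 != m.
  have [->|m0] := eqVneq m ord0; last by exists ord0; rewrite eq_sym.
  by exists ord_max; rewrite -val_eqE /= -lt0n.
have [i0 i0m xi0] := @exists_argmax R 'I_N [pred j | j != m] x i1 i1m.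
have rho_xm : x i0 <= x m by exact: xm.
have C0 : 0 <= C by move: C_ge1; lra.
have aE : cabs (a m) ^+ 2 = 1 + x m ^+ 2 by have := ab m; rewrite /x; lra.
have a1 : 1 <= cabs (a m) by exact: SU11_diag_ge1.
have cN : #|'I_N|%:R = N%:R :> R by rewrite card_ord.
have [rho1|rho1] := leP (x i0) 1; last first.
  apply: (ln_bound_two_ge1 (c := c) (x := x) p1 p2 c0 i0m K0 rho_xm (B := B4));
    rewrite ?(ltW rho1) //.
  - by rewrite exprn_ege1 // ler1n.
  - by rewrite cN /beta_scale; move: t1 t2 t3; lra.
  move=> j; have [cj _] := prod_coef_le_prod a b N j.
  apply: (@le_trans _ _ ((\prod_(l < N) (cabs (a l) + x l)) ^+ 2)).
    rewrite ler_sqr ?nnegrE ?c0 //; last first.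
      by apply: prodr_ge0 => l _; rewrite addr_ge0 ?cabs_ge0.
    by apply: le_trans cj _; under eq_bigr do rewrite inord_val.
  have -> : B4 = \prod_(l < N) 4 by rewrite prodr_const card_ord.
  rewrite -prodrXl -big_split /=; apply: ler_prod => l _.
  rewrite sqr_ge0 /=.
  have al0 := cabs_ge0 (a l); have xl0 := x0 l; have abl := ab l.
  rewrite /x in xl0 *.
  by have := sqr_ge0 (cabs (a l) - cabs (b l)); nra.
have dom := prod_coef_dominant ab (x0 i0) rho1 rho_xm xi0.
have cm : c m <= x m + C * (x m * x i0 ^+ 2) by have [] := dom m.
have cj j : j != m -> c j <= x j * cabs (a m) + C * (x m * x i0 ^+ 2).
  by have [] := dom j.
have [xm0|xmn0] := eqVneq (x m) 0.
  apply: (ln_bound_no_growth (c := c) (x := x) (m := m) p1 x0 K0).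
  rewrite big1 ?powR_ge0 // => j _.
  have -> : c j = 0.
    have [->|jm] := eqVneq j m.
      by apply/eqP; rewrite eq_le c0 andbT (le_trans cm) // xm0 mul0r mulr0 addr0.
    apply/eqP; rewrite eq_le c0 andbT (le_trans (cj j jm)) // xm0 mul0r mulr0 addr0.
    have -> : x j = 0 by apply/eqP; rewrite eq_le x0 andbT -xm0 xm.
    by rewrite mul0r.
  by rewrite powR0 // gt_eqF //; lra.
have xmp : 0 < x m by rewrite lt_def xmn0 x0.
have [xm1|xm1] := leP (x m) 1.
  apply: (ln_bound_max_le1 (c := c) (x := x) p1 p2 x0 c0 i0m C0 K0 xi0 rho_xm
    (C2 := C2) xmp xm1 aE a1) => //.
    by rewrite cN.
  move=> u u0 uK; apply: ln1D_gain => //.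
  by rewrite /beta_scale; move: t1 t2 t3; lra.
apply: (ln_bound_max_ge1 (c := c) (x := x) p1 p2 x0 c0 i0m C0 K0 xi0
  (C4 := C4) (ltW xm1) rho1 aE) => //.
- by lra.
- by rewrite cN.
- rewrite -[leLHS]expRK ler_ln ?posrE ?expR_gt0 //; last by move: K0; lra.
  by rewrite /beta_scale; move: t1 t2 t3; lra.
Qed.
End Assembly.

Unset Implicit Arguments.

Theorem proposition2p4 (R : realType) (d : nat) (hd : (2 <= d)%N) :
  exists (C : R) (beta : R -> R),
    0 < C /\
    (forall x : R, 0 <= x -> 0 <= beta x) /\
    (forall a b : R[i], SU11 R (su_mx a b) ->
       C^-1 * Num.sqrt (ln (cabs a)) <= beta (cabs b) /\
       beta (cabs b) <= C * Num.sqrt (ln (cabs a))) /\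
    (forall a b A B : 'I_d -> R[i],
       (forall j : 'I_d, SU11 R (su_mx (a j) (b j))) ->
       (forall k : 'I_d, SU11 R (su_mx (A k) (B k))) ->
       (forall k : 'I_d,
          su_mx (A k) (B k) =
          \prod_(j < d)
            mx2 (a j) (conjc (b j) * expi (- (2 * pi * j%:R * k%:R / d%:R)))
                (b j * expi (2 * pi * j%:R * k%:R / d%:R)) (conjc (a j))) ->
       forall p q : R, 1 < p -> p <= 2 -> 2 <= q -> p^-1 + q^-1 = 1 ->
         (d%:R^-1 * \sum_(k < d) beta (cabs (B k)) `^ q) `^ q^-1
         <= (\sum_(j < d) beta (cabs (b j)) `^ p) `^ p^-1).
Proof.
case: d hd => [//|d] hd; set N := d.+1.
pose K := beta_scale R d; have K1 : 1 <= K := beta_scale_ge1 R d.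
have K0 : 0 < K by lra.
pose beta (t : R) := Num.sqrt (ln (1 + K * t ^+ 2)).
have Kt0 (t : R) : 0 <= K * t ^+ 2 by rewrite mulr_ge0 ?sqr_ge0 // ltW.
have Lt0 (t : R) : 0 <= ln (1 + K * t ^+ 2) by exact: ln1D_ge0.
have beta_powR (t r : R) : beta t `^ r = ln (1 + K * t ^+ 2) `^ (r / 2).
  by rewrite /beta -powR12_sqrt // -powRrM (mulrC r).
exists (Num.sqrt (2 * K)), beta; split; first by rewrite sqrtr_gt0 mulr_gt0.
split; first by move=> t _; exact: sqrtr_ge0.
split.
  move=> a b /SU11_su_mx ab.
  have a2 : cabs a ^+ 2 = 1 + cabs b ^+ 2 by lra.
  have b20 := sqr_ge0 (cabs b).
  have a_gt0 : 0 < cabs a.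
    rewrite lt_def cabs_ge0 andbT; apply/eqP => a0; move: a2.
    by rewrite a0 expr0n /=; lra.
  have lnE : ln (1 + cabs b ^+ 2) = 2 * ln (cabs a) by rewrite -a2 lnXn // mulr_natl.
  have lnb0 : 0 <= ln (1 + cabs b ^+ 2) by exact: ln1D_ge0.
  have lna0 : 0 <= ln (cabs a) by lra.
  have le1 : ln (1 + cabs b ^+ 2) <= ln (1 + K * cabs b ^+ 2).
    by rewrite ler_ln1D // ler_peMl.
  split.
    rewrite mulrC ler_pdivrMr ?sqrtr_gt0 ?mulr_gt0 // -sqrtrM //.
    rewrite ler_wsqrtr //.
    have : ln (1 + K * cabs b ^+ 2) * 1 <= ln (1 + K * cabs b ^+ 2) * (2 * K).
      by rewrite ler_wpM2l //; lra.
    by lra.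
  rewrite /beta -sqrtrM; last by rewrite mulr_ge0 // ltW.
  rewrite ler_wsqrtr // mulrAC -lnE.
  have [->|b0] := eqVneq (cabs b ^+ 2) 0; first by rewrite mulr0 addr0 ln1 mul0r.
  have b2p : 0 < cabs b ^+ 2 by rewrite lt_def b0.
  have := @ln1D_ratio_anti R (cabs b ^+ 2) (K * cabs b ^+ 2) (mulr_gt0 K0 b2p) b20.
  rewrite ler_peMl // => /(_ isT).
  move=> H; rewrite -(ler_pM2l b2p); apply: le_trans H _.
  by rewrite le_eqVlt; apply/orP; left; apply/eqP; ring.
move=> a b A B ab _ AB p q p1 p2 q2 pq.
have ab1 j : cabs (a j) ^+ 2 - cabs (b j) ^+ 2 = 1 by exact/SU11_su_mx.
pose c := (prod_coef a b N).1.
have Bc k : B k = transform (@dft R d) c k.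
  have := prod_su_mxE a b k (leqnn N).
  under eq_bigr do rewrite inord_val.
  have -> : \prod_(j < N) su_mx (a j) (b j * dft R k j) = su_mx (A k) (B k).
    rewrite AB; apply: eq_bigr => j _.
    by rewrite /su_mx conjcM /dft -expiN.
  by move=> /su_mx_inj [].
have p0 : 0 < p by lra.
have q0 : 0 < q by lra.
have dV : 0 <= N%:R^-1 :> R by rewrite invr_ge0.
pose S := \sum_j cabs (c j) `^ p.
have S0 : 0 <= S by apply: sumr_ge0 => j _; exact: powR_ge0.
have dft1 (k j : 'I_N) : cabs (dft R k j) <= 1 by rewrite cabs_dft.
have HY := hausdorff_young (ltn0Sn d) dft1 (@dft_orth R d) c p1 q2 pq.
pose T := N%:R^-1 * \sum_k cabs (B k) `^ q.
have T0 : 0 <= T by rewrite mulr_ge0 // sumr_ge0 // => k _; exact: powR_ge0.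
have TS : T `^ q^-1 <= S `^ p^-1.
  by move: HY; under eq_bigr do rewrite -Bc.
under eq_bigr do rewrite beta_powR.
under [X in _ <= X `^ _]eq_bigr do rewrite beta_powR.
pose r := q / 2.
have r1 : 1 <= r by rewrite ler_pdivlMr // mul1r.
have r0 : 0 < r by rewrite divr_gt0.
have := jensen_ln1D (ltn0Sn d) r1 (fun k => Kt0 (cabs (B k))).
have -> : (N%:R^-1 * \sum_k (K * cabs (B k) ^+ 2) `^ r) `^ r^-1 = K * (T `^ q^-1) ^+ 2.
  have -> : N%:R^-1 * \sum_k (K * cabs (B k) ^+ 2) `^ r = K `^ r * T.
    rewrite /T [RHS]mulrCA [in RHS]mulr_sumr; congr (_ * _); apply: eq_bigr => k _.
    rewrite powRM ?sqr_ge0 ?(ltW K0) // -powR_mulrn ?cabs_ge0 // -powRrM.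
    by congr (_ * _ `^ _); rewrite /r; field.
  rewrite powRM ?powR_ge0 // -powRrM divff ?gt_eqF // powRr1 ?(ltW K0) //.
  rewrite -powR_mulrn ?powR_ge0 // -powRrM; congr (_ * _ `^ _).
  by rewrite /r; field; rewrite gt_eqF.
set X := N%:R^-1 * _ => HX.
have X0 : 0 <= X by rewrite mulr_ge0 // sumr_ge0 // => k _; exact: powR_ge0.
set M := K * S `^ (2 / p).
have M0 : 0 <= M by rewrite mulr_ge0 ?powR_ge0 // ltW.
have XM : X <= ln (1 + M) `^ r.
  apply: le_trans HX _; apply: ge0_ler_powR; rewrite ?nnegrE ?ln1D_ge0 ?(ltW r0) //.
  apply: ler_ln1D => //; rewrite /M ler_pM2l //.
  have -> : S `^ (2 / p) = (S `^ p^-1) ^+ 2.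
    by rewrite -powR_mulrn ?powR_ge0 // -powRrM mulrC.
  by rewrite ler_sqr ?nnegrE ?powR_ge0.
have HP := prod_coef_ln_bound hd p1 p2 ab1; rewrite -/S -/M in HP.
apply: (@le_trans _ _ ((ln (1 + M) `^ r) `^ q^-1)).
  by apply: ge0_ler_powR; rewrite ?nnegrE ?powR_ge0 ?invr_ge0 ?(ltW q0).
have -> : (ln (1 + M) `^ r) `^ q^-1 = (ln (1 + M) `^ (p / 2)) `^ p^-1.
  by rewrite -!powRrM; congr (_ `^ _); rewrite /r; field; rewrite !gt_eqF.
apply: ge0_ler_powR; rewrite ?nnegrE ?powR_ge0 ?invr_ge0 ?(ltW p0) //.
by apply: sumr_ge0 => j _; exact: powR_ge0.
Qed.
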